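(* $\mathcal{M}_P(\Delta^3)\simeq\mathcal{M}_P(\partial\Delta^3)\simeq\bigvee^{81}S^3$.
   Context: All simplicial complexes are finite abstract simplicial complexes; simplices are nonempty. $\Delta^3$ is the simplicial complex of all nonempty subsets of a $4$-element vertex set and $\partial\Delta^3$ its subcomplex of proper nonempty subsets. The Hasse diagram $\mathcal{H}(K)$ of $K$ is the directed graph whose vertices are the simplices of $K$, with an edge $\sigma\to\tau$ whenever $\sigma\subsetneq\tau$ and $\dim\tau=\dim\sigma+1$. A matching on $\mathcal{H}(K)$ is a set $W$ of edges of $\mathcal{H}(K)$, no two sharing a vertex. $W$ is acyclic if the directed graph obtained from $\mathcal{H}(K)$ by reversing every edge in $W$ has no directed cycle. The complex of discrete Morse matchings $\mathcal{M}(K)$ is the simplicial complex whose vertices are the edges of $\mathcal{H}(K)$ and whose simplices are the nonempty acyclic matchings on $\mathcal{H}(K)$. The pure complex $\mathcal{M}_P(K)$ is the subcomplex of $\mathcal{M}(K)$ generated by (consisting of all faces of) the simplices of $\mathcal{M}(K)$ of maximum dimension, i.e. the acyclic matchings of maximum cardinality. *)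

(* Defs.v *)
From HB Require Import structures.
From mathcomp Require Import all_boot all_order all_algebra.
From mathcomp Require Import all_classical all_reals all_analysis.
Import numFieldNormedType.Exports.
Set Implicit Arguments. Unset Strict Implicit. Unset Printing Implicit Defensive.
Import Order.TTheory GRing.Theory Num.Theory.
Local Open Scope classical_set_scope.
Local Open Scope ring_scope.

Definition is_complex (V : finType) (K : {set {set V}}) : bool :=
  [forall s in K, (0 < #|s|)%N &&
     [forall t : {set V}, ((0 < #|t|)%N && (t \subset s)) ==> (t \in K)]].

Definition Delta3 : {set {set 'I_4}} := [set s : {set 'I_4} | (0 < #|s|)%N].
Definition bDelta3 : {set {set 'I_4}} :=
  [set s : {set 'I_4} | (0 < #|s| < 4)%N].

Definition hasse_edges (V : finType) (K : {set {set V}})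
  : {set {set V} * {set V}} :=
  [set e | [&& e.1 \in K, e.2 \in K, e.1 \proper e.2 &
              #|e.2| == #|e.1|.+1]].

Definition is_matching (V : finType) (K : {set {set V}})
  (W : {set {set V} * {set V}}) : bool :=
  (W \subset hasse_edges K) &&
  [forall e in W, forall f in W,
     (e != f) ==> [&& e.1 != f.1, e.1 != f.2, e.2 != f.1 & e.2 != f.2]].

Definition modified_hasse (V : finType) (K : {set {set V}})
  (W : {set {set V} * {set V}}) : rel {set V} :=
  fun x y => (((x, y) \in hasse_edges K) && ((x, y) \notin W))
             || ((y, x) \in W).

(* W acyclic: the modified digraph has no directed cycle (a directed cycle
   exists iff some edge x -> y can be closed by a directed path y ~> x). *)
Definition is_acyclic (V : finType) (K : {set {set V}})
  (W : {set {set V} * {set V}}) : bool :=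
  [forall x, forall y,
     modified_hasse K W x y ==> ~~ connect (modified_hasse K W) y x].

Definition acyclic_matching (V : finType) (K : {set {set V}})
  (W : {set {set V} * {set V}}) : bool :=
  is_matching K W && is_acyclic K W.

Definition morse_complex (V : finType) (K : {set {set V}})
  : {set {set {set V} * {set V}}} :=
  [set W : {set {set V} * {set V}} | (0 < #|W|)%N && acyclic_matching K W].

Definition max_acyclic_size (V : finType) (K : {set {set V}}) : nat :=
  \max_(W : {set {set V} * {set V}} | acyclic_matching K W) #|W|.

Definition pure_morse_complex (V : finType) (K : {set {set V}})
  : {set {set {set V} * {set V}}} :=
  [set W : {set {set V} * {set V}} | (0 < #|W|)%N &&
     [exists M : {set {set V} * {set V}}, [&& acyclic_matching K M, #|M| == max_acyclic_size K
                  & W \subset M]]].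

Definition realization (R : realType) (V : finType) (K : {set {set V}})
  : set {ptws V -> R} :=
  [set x | (forall v, 0 <= x v) /\ (\sum_(v : V) x v = 1) /\
           finset (fun v : V => x v != 0) \in K].

Definition homotopic_on (R : realType) (T1 T2 : topologicalType)
  (A : set T1) (B : set T2) (f g : T1 -> T2) : Prop :=
  exists H : R * T1 -> T2,
    {within `[0%R, 1%R] `*` A, continuous H} /\
    (forall t x, t \in `[0%R, 1%R] -> A x -> B (H (t, x))) /\
    (forall x, A x -> H (0%R, x) = f x /\ H (1%R, x) = g x).

Definition homotopy_equivalent (R : realType) (T1 T2 : topologicalType)
  (A : set T1) (B : set T2) : Prop :=
  exists (f : T1 -> T2) (g : T2 -> T1),
    {within A, continuous f} /\ f @` A `<=` B /\
    {within B, continuous g} /\ g @` B `<=` A /\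
    homotopic_on R A A (g \o f) id /\ homotopic_on R B B (f \o g) id.

(* Realized in R^4 as n nested 3-spheres, the k-th one (k = 1..n) of radius
   k centred at (k,0,0,0); they pairwise meet exactly at the origin, so the
   union is the one-point union (wedge) of n copies of S^3. *)
Definition wedge_S3 (R : realType) (n : nat) : set {ptws 'I_4 -> R} :=
  [set x | exists2 k : nat, (1 <= k <= n)%N &
     \sum_(i < 4) (x i - (if i == ord0 then k%:R else 0)) ^+ 2 = k%:R ^+ 2].

Arguments realization R {V} K.
Arguments homotopic_on R {T1 T2} A B f g.
Arguments homotopy_equivalent R {T1 T2} A B.
Arguments wedge_S3 : clear implicits.

(* Main.v *)
(** Removing the open star of a face [s] whose star is a cone with apex [v] is
    a strong deformation retraction: slide mass from the vertices of [s] to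
    [v].  A sequence of such collapses takes the pure complex of Delta^3 to
    that of its boundary (256 facets each), and a second one takes the latter
    to a 3-dimensional complex [C].  Deleting 81 suitable tetrahedra from [C]
    leaves a subcomplex [L] that collapses to a point.  The contraction of [L]
    extends to a homotopy of [C] by the homotopy extension property, one
    tetrahedron at a time.  The map [q] from [C] to the bouquet that sends [L]
    to the origin and the k-th open tetrahedron onto the k-th punctured sphere
    by inverse stereographic projection is a quotient map because [C] is
    compact, so the end of that homotopy factors through [q] and provides a
    homotopy inverse.  The facets and the collapse sequences are verified by
    computation. *)
Require Import Defs.
From mathcomp Require Import all_boot all_order all_algebra.
From mathcomp Require Import all_classical all_reals all_analysis.
From mathcomp Require Import ring lra.
Import numFieldNormedType.Exports.
Set Implicit Arguments. Unset Strict Implicit. Unset Printing Implicit Defensive.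
Import Order.TTheory GRing.Theory Num.Theory.
Local Open Scope classical_set_scope.
Local Open Scope ring_scope.


(** * Strong deformation retracts and quotients *)

(** Why the two pure complexes are so close: a maximum acyclic matching on Delta^3 leaves a single
    vertex unmatched and so has 7 edges, one on the boundary leaves a vertex and a triangle and has
    6. Dropping the edge into the tetrahedron turns the former into the latter, the freed triangle
    being the unmatched one, and this is a bijection. Each facet of the first pure complex is thus a
    facet of the second joined with one of four extra vertices, and the first collapse only has to
    eliminate these four. What shapes the topological part is that maps are total and continuous
    only within a subset, so a homotopy on [0,1] x A is arbitrary elsewhere. Gluing is therefore
    done by pasting along closed sets through [extend0], and the explicit formulas ([slide],
    [ext_scale], [bubble]) are arranged to be continuous on the whole space, with denominators that
    never vanish. Continuity of a map out of the bouquet cannot be read off a formula, because it is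
    defined through a set-theoretic section; it is always obtained from a compact source. *)

Lemma within_comp (T U W : topologicalType) (A : set T) (B : set U)
    (f : T -> U) (g : U -> W) :
  {within A, continuous f} -> {within B, continuous g} ->
  (forall x, A x -> B (f x)) -> {within A, continuous (fun x => g (f x))}.
Proof.
move=> /subspace_continuousP cf /subspace_continuousP cg AB.
apply/subspace_continuousP => x Ax.
apply: (@cvg_comp _ _ _ f g _ (within B (nbhs (f x)))); last exact/cg/AB.
move=> V BV; have := cf x Ax _ BV.
rewrite !nbhs_simpl /within /=; apply: filterS => y /[swap] Ay /(_ Ay).
by apply; exact: AB.
Qed.

Lemma eq_within (T U : topologicalType) (A : set T) (f g : T -> U) :
  (forall x, A x -> f x = g x) -> {within A, continuous f} ->
  {within A, continuous g}.
Proof.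
by move=> fg; apply: subspace_eq_continuous => x /set_mem; exact: fg.
Qed.

Lemma within_pair (T U W : topologicalType) (A : set T) (f : T -> U)
    (g : T -> W) :
  {within A, continuous f} -> {within A, continuous g} ->
  {within A, continuous (fun x => (f x, g x))}.
Proof. by move=> cf cg x; apply: cvg_pair; [exact: cf|exact: cg]. Qed.

Lemma fst_cont (T U : topologicalType) : continuous (@fst T U).
Proof. by move=> x; exact: cvg_fst. Qed.

Lemma snd_cont (T U : topologicalType) : continuous (@snd T U).
Proof. by move=> x; exact: cvg_snd. Qed.

Lemma closed_setX (T U : topologicalType) (A : set T) (B : set U) :
  closed A -> closed B -> closed (A `*` B).
Proof.
move=> cA cB; rewrite (_ : A `*` B = fst @^-1` A `&` snd @^-1` B)//.
by apply: closedI; apply: preimage_closed => // x _;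
  [exact: fst_cont|exact: snd_cont].
Qed.

(** The preimage in [X] of a closed set under the composite is closed, hence compact; its image
    under [q] is compact, hence closed in the Hausdorff space [U]. *)
Lemma continuous_quotient (T U W : topologicalType) (X : set T) (q : T -> U)
    (g : U -> W) :
  compact X -> hausdorff_space U -> {within X, continuous q} ->
  {within X, continuous (fun x => g (q x))} ->
  {within q @` X, continuous g}.
Proof.
move=> cX hU cq cgq; apply/continuous_closedP => C clC.
have /continuous_closedP/(_ _ clC)/closed_subspaceP[V clV VX] := cgq.
apply/closed_subspaceP; exists (q @` (X `&` V)).
  apply: compact_closed => //; apply: continuous_compact.
    by apply: continuous_subspaceW cq; exact: subIsetl.
  exact: compact_closedI.
rewrite setIC in VX; rewrite VX; apply/seteqP; split => y /=.
  by move=> [[x [Cx Xx] <-] _]; split=> //; exists x.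
by move=> [Cy [x Xx qx]]; rewrite -qx in Cy *; split; exists x.
Qed.

Section deformation.
Variables (R : realType) (T : topologicalType).
Implicit Types (X A B L : set T).

Definition strong_deformation_retract X A := exists H : R * T -> T,
  [/\ {within `[0%R, 1%R] `*` X, continuous H},
      forall t x, t \in `[0%R, 1%R] -> X x -> X (H (t, x)),
      forall x, X x -> H (0, x) = x,
      forall x, X x -> A (H (1, x)) &
      A `<=` X /\ forall t x, t \in `[0%R, 1%R] -> A x -> H (t, x) = x].

(** A contraction of [L] within itself that has been extended to a homotopy of the ambient [X]: this
    is the data from which [X] is shown to be equivalent to the quotient of [X] by [L]. *)
Definition contracts_in X L e := exists H : R * T -> T,
  [/\ {within `[0%R, 1%R] `*` X, continuous H},
      forall t x, t \in `[0%R, 1%R] -> X x -> X (H (t, x)),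
      forall x, X x -> H (0, x) = x,
      forall t x, t \in `[0%R, 1%R] -> L x -> L (H (t, x)) &
      forall x, L x -> H (1, x) = e].

(** Forces the identity at time 0, also at points outside the set on which [H] is known to be a
    homotopy. *)
Definition extend0 (H : R * T -> T) (z : R * T) :=
  if z.1 == 0 then z.2 else H z.

(** Pasting lemma: on the closed set {0} x T the map is the projection, on the closed set [0,1] x A
    it is [H], and the two agree where both apply. *)
Lemma extend0_within (Z : topologicalType) (Y : set Z) (H : R * T -> T) A
    (tau : Z -> R) (p : Z -> T) :
  closed A -> {within `[0%R, 1%R] `*` A, continuous H} ->
  (forall x, A x -> H (0, x) = x) ->
  {within Y, continuous tau} -> {within Y, continuous p} ->
  (forall z, Y z -> tau z = 0 \/ tau z \in `[0%R, 1%R] /\ A (p z)) ->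
  {within Y, continuous (fun z => extend0 H (tau z, p z))}.
Proof.
move=> clA cH H0 ctau cp tauP.
apply: (@within_comp Z (R * T)%type T Y
  ([set 0] `*` setT `|` `[0%R, 1%R] `*` A)
  (fun z => (tau z, p z)) (extend0 H)).
- exact: within_pair.
- apply: withinU_continuous.
  + by apply: closed_setX; [exact: closed_eq|exact: closedT].
  + by apply: closed_setX => //; exact: interval_closed.
  + apply: (@eq_within _ _ _ snd).
      by move=> [t x] /= [-> _]; rewrite /extend0 eqxx.
    exact/continuous_subspaceT/snd_cont.
  + apply: (eq_within _ cH) => -[t x] [/= _ Ax].
    by rewrite /extend0 /=; case: eqP => // ->; rewrite H0.
- by move=> z /tauP[z0|[zI Az]]; [left|right].
Qed.

Lemma within_clamp (X : set T) (c : R -> R) : continuous c ->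
  {within `[0%R, 1%R] `*` X, continuous (fun z : R * T => c z.1)}.
Proof.
move=> cc; apply: continuous_subspaceT => z.
by apply: continuous_comp; [exact: fst_cont|exact: cc].
Qed.

Definition first_half (t : R) := Num.min 1 (t *+ 2).
Definition second_half (t : R) := Num.max 0 (t *+ 2 - 1).

Lemma first_half_cont : continuous first_half.
Proof.
move=> t; apply: (@continuous_min R R (cst 1) (fun t : R => t *+ 2)).
  exact: cvg_cst.
by apply: cvgMn; exact: cvg_id.
Qed.

Lemma second_half_cont : continuous second_half.
Proof.
move=> t; apply: (@continuous_max R R (cst 0) (fun t : R => t *+ 2 - 1 : R)).
  exact: cvg_cst.
by apply: cvgB; [apply: cvgMn; exact: cvg_id|exact: cvg_cst].
Qed.

Lemma first_half_itv t : t \in `[0%R, 1%R] -> first_half t \in `[0%R, 1%R].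
Proof.
rewrite !in_itv /= => /andP[t0 t1].
by rewrite le_min ge_min lexx ler01 mulrn_wge0.
Qed.

Lemma second_half_itv t : t \in `[0%R, 1%R] -> second_half t \in `[0%R, 1%R].
Proof.
rewrite !in_itv /= => /andP[t0 t1].
by rewrite le_max ge_max lexx ler01 /=; lra.
Qed.

Lemma half_cases t : second_half t = 0 \/ first_half t = 1.
Proof.
rewrite /first_half /second_half; case: (lerP 1 (t *+ 2)) => h; [right|left].
  by [].
by rewrite max_l//; lra.
Qed.

Lemma first_half0 : first_half 0 = 0.
Proof. by rewrite /first_half mul0rn min_r. Qed.

Lemma second_half0 : second_half 0 = 0.
Proof. by rewrite /second_half mul0rn sub0r max_l// lerN10. Qed.

Lemma first_half1 : first_half 1 = 1.
Proof. by rewrite /first_half min_l//; lra. Qed.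

Lemma second_half1 : second_half 1 = 1.
Proof. by rewrite /second_half max_r; lra. Qed.

(* Traverses [H1], then [H2]: for times at most 1/2 the time fed to [H2] is 0,
   where [extend0] ignores that [H2] is only meaningful on [A]. *)
Definition concat (H1 H2 : R * T -> T) (z : R * T) :=
  extend0 H2 (second_half z.1, H1 (first_half z.1, z.2)).

Lemma concat_within X A (H1 H2 : R * T -> T) : closed A ->
  {within `[0%R, 1%R] `*` X, continuous H1} ->
  (forall x, X x -> A (H1 (1, x))) ->
  {within `[0%R, 1%R] `*` A, continuous H2} ->
  (forall x, A x -> H2 (0, x) = x) ->
  {within `[0%R, 1%R] `*` X, continuous (concat H1 H2)}.
Proof.
move=> clA c1 H1A c2 H20; apply: (@extend0_within _ _ _ A) => //.
- exact/within_clamp/second_half_cont.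
- apply: (@within_comp _ (R * T)%type _ _ (`[0%R, 1%R] `*` X)
    (fun z : R * T => (first_half z.1, z.2)) H1) => //.
    apply: within_pair; first exact/within_clamp/first_half_cont.
    exact/continuous_subspaceT/snd_cont.
  by move=> [t x] [/= t01 Xx]; split => //; exact: first_half_itv.
- move=> [t x] [/= t01 Xx]; have [->|->] := half_cases t; first by left.
  by right; split; [exact: second_half_itv|exact: H1A].
Qed.

Lemma concatP (H1 H2 : R * T -> T) t x :
  concat H1 H2 (t, x) = H1 (first_half t, x) \/
  concat H1 H2 (t, x) = H2 (second_half t, H1 (1, x)).
Proof.
rewrite /concat /extend0 /=; case: (half_cases t) => [->|->].
  by left; rewrite eqxx.
by case: ifP; [left|right].
Qed.

Lemma concat0 (H1 H2 : R * T -> T) x : concat H1 H2 (0, x) = H1 (0, x).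
Proof. by rewrite /concat /extend0 /= second_half0 first_half0 eqxx. Qed.

Lemma concat1 (H1 H2 : R * T -> T) x :
  concat H1 H2 (1, x) = H2 (1, H1 (1, x)).
Proof.
by rewrite /concat /extend0 /= second_half1 first_half1 oner_eq0.
Qed.

Lemma strong_deformation_retract_refl X : strong_deformation_retract X X.
Proof.
exists snd; split => //; last by split.
by apply: continuous_subspaceT; exact: snd_cont.
Qed.

Lemma strong_deformation_retract_trans X A B : closed A ->
  strong_deformation_retract X A -> strong_deformation_retract A B ->
  strong_deformation_retract X B.
Proof.
move=> clA [H1 [c1 H1X H10 H1A [AX H1id]]] [H2 [c2 H2A H20 H2B [BA H2id]]].
have i1 : (1 : R) \in `[0%R, 1%R] by rewrite in_itv /= ler01 lexx.
exists (concat H1 H2); split.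
- exact: (concat_within clA).
- move=> t x t01 Xx; case: (concatP H1 H2 t x) => ->.
    by apply: H1X => //; exact: first_half_itv.
  by apply/AX/H2A; [exact: second_half_itv|exact: H1A].
- by move=> x Xx; rewrite concat0 H10.
- by move=> x Xx; rewrite concat1; exact/H2B/H1A.
- split=> [x /BA/AX//|t x t01 Bx].
  case: (concatP H1 H2 t x) => ->.
    by rewrite H1id//; [exact: first_half_itv|exact: BA].
  by rewrite H1id// ?H2id//; [exact: second_half_itv|exact: BA].
Qed.

Lemma strong_deformation_retract_equiv X A :
  strong_deformation_retract X A -> homotopy_equivalent R X A.
Proof.
move=> [H [cH HX H0 HA [AX Hid]]].
have i1 : (1 : R) \in `[0%R, 1%R] by rewrite in_itv /= ler01 lexx.
(* A deformation starts at the identity while [homotopic_on] wants it at the end, so time is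
   reversed. *)
have flip (t : R) : t \in `[0%R, 1%R] -> 1 - t \in `[0%R, 1%R].
  by rewrite !in_itv /= => /andP[? ?]; apply/andP; split; lra.
have cflip (Y : set T) : Y `<=` X ->
    {within `[0%R, 1%R] `*` Y, continuous (fun z : R * T => H (1 - z.1, z.2))}.
  move=> YX; apply: (@within_comp _ (R * T)%type _ _ (`[0%R, 1%R] `*` X)
    (fun z : R * T => (1 - z.1, z.2)) H) => //.
    apply: within_pair; last exact/continuous_subspaceT/snd_cont.
    apply: (@within_clamp _ (fun t => 1 - t)) => t.
    by apply: cvgB; [exact: cvg_cst|exact: cvg_id].
  by move=> [t x] [/= /flip t01 /YX].
exists (fun x => H (1, x)), id; split.
  apply: (@within_comp _ (R * T)%type _ _ (`[0%R, 1%R] `*` X) (fun x => (1, x)) H) => //.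
  by apply: within_pair; apply: continuous_subspaceT => x;
    [exact: cvg_cst|exact: cvg_id].
split; first by move=> _ [x /HA Hx <-].
split; first by apply: continuous_subspaceT => x; exact: cvg_id.
split; first by move=> _ [x /AX Ax <-].
split; exists (fun z => H (1 - z.1, z.2)).
  split; first exact: cflip.
  split=> [t x /flip t01 Xx|x Xx]; first exact: HX.
  by rewrite /= subr0 subrr H0.
split; first exact: cflip.
split=> [t x /flip t01 Ax /=|x Ax /=]; first by rewrite Hid.
by rewrite subr0 subrr !Hid// in_itv /= lexx ler01.
Qed.

(** Here [W] is the quotient of [K] by [L]. One map is [q] after the retraction [D] at time 1. The
    inverse sends [y] to the time-1 image under [H] of any preimage of [y], which is well defined
    because [H] ends by crushing [L] to [e]. *)
Lemma quotient_homotopy_equivalent (U : topologicalType) (X K L : set T)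
    (W : set U) (q : T -> U) (e : T) (o : U) :
  hausdorff_space U -> closed K -> compact K ->
  strong_deformation_retract X K -> contracts_in K L e -> L `<=` K ->
  {within K, continuous q} -> q @` K = W ->
  (forall x, L x -> q x = o) ->
  (forall x y, K x -> K y -> q x = q y -> x = y \/ L x /\ L y) ->
  homotopy_equivalent R X W.
Proof.
move=> hU clK cptK [D [cD DX D0 DK [KX Did]]] [H [cH HK H0 HL He]] LK cq qK qL qI.
have i1 : (1 : R) \in `[0%R, 1%R] by rewrite in_itv /= ler01 lexx.
have flip (t : R) : t \in `[0%R, 1%R] -> 1 - t \in `[0%R, 1%R].
  by rewrite !in_itv /= => /andP[? ?]; apply/andP; split; lra.
have cflip (S : topologicalType) (Y : set S) : {within `[0%R, 1%R] `*` Y,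
    continuous (fun z : R * S => (1 - z.1, z.2))}.
  apply: within_pair; last exact/continuous_subspaceT/snd_cont.
  apply: continuous_subspaceT => -[t x].
  apply: cvgB; [exact: cvg_cst|exact: fst_cont].
have cpair1 (Y : set T) : {within Y, continuous (fun x => (1 : R, x))}.
  by apply: within_pair; apply: continuous_subspaceT => x;
    [exact: cvg_cst|exact: cvg_id].
(* A set-theoretic section of [q], in general discontinuous at [o]. The choice made there disappears
   after applying [H] at time 1 ([H1s]), or [q] after [H] at any time ([qHs]). *)
pose s y := xget e [set x | K x /\ q x = y].
have sP x : K x -> K (s (q x)) /\ q (s (q x)) = q x.
  by move=> Kx; rewrite /s; case: xgetP => [y _ []//|no]; case: (no x).
have sK x : K x -> s (q x) = x \/ L (s (q x)) /\ L x.
  by move=> Kx; have [Ks qs] := sP x Kx; exact: qI.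
have H1s x : K x -> H (1, s (q x)) = H (1, x).
  by move=> /sK[->//|[/He-> /He->]].
have qHs t x : t \in `[0%R, 1%R] -> K x -> q (H (t, s (q x))) = q (H (t, x)).
  move=> t01 /sK[->//|[/(HL _ _ t01)/qL sL /(HL _ _ t01)/qL xL]].
  by rewrite sL xL.
have cH1 : {within K, continuous (fun x => H (1, x))}.
  by apply: (@within_comp _ (R * T)%type _ _ (`[0%R, 1%R] `*` K) _ H).
have cD1 : {within X, continuous (fun x => D (1, x))}.
  by apply: (@within_comp _ (R * T)%type _ _ (`[0%R, 1%R] `*` X) _ D).
exists (fun x => q (D (1, x))), (fun y => H (1, s y)); split.
  exact: (@within_comp _ _ _ _ K).
split; first by move=> _ [x /DK Dx <-]; rewrite -qK; exists (D (1, x)).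
split.
  rewrite -qK; apply: continuous_quotient => //.
  by apply: eq_within cH1 => x Kx; rewrite H1s.
split; first by move=> _ [y + <-]; rewrite -qK => -[x /sP[Kx _] <-]; exact/KX/HK.
(* Retracting first and then running [H] joins the identity of [X] to the round trip through [W]. *)
have cDH : {within `[0%R, 1%R] `*` X, continuous (concat D H)}.
  exact: (concat_within clK).
split.
  exists (fun z => concat D H (1 - z.1, z.2)); split.
    apply: (@within_comp _ (R * T)%type _ _ (`[0%R, 1%R] `*` X) _
      (concat D H)) => // -[t x].
    by move=> [/= /flip t01 Xx].
  split=> [t x /flip t01 Xx /=|x Xx /=]; last first.
    by rewrite subr0 subrr concat0 concat1 D0// H1s//; exact: DK.
  case: (concatP D H (1 - t) x) => ->.
    by apply: DX => //; exact: first_half_itv.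
  by apply/KX/HK; [exact: second_half_itv|exact: DK].
exists (fun z => q (H (1 - z.1, s z.2))); split.
  (* Continuity on [0,1] x W is tested on the compact set [0,1] x K, which [qq] maps onto it; there
     [qHs] lets the section be dropped. *)
  pose qq (z : R * T) := (z.1, q z.2).
  have -> : `[0%R, 1%R] `*` W = qq @` (`[0%R, 1%R] `*` K).
    rewrite -qK; apply/seteqP; split.
      by move=> [t _] [/= t01 [x Kx <-]]; exists (t, x).
    by move=> _ [[t x] [/= t01 Kx] <-]; split => //=; exists x.
  apply: continuous_quotient.
  - by apply: compact_setX => //; exact: segment_compact.
  - move=> [t x] [t' x'] /= cl; congr pair.
      apply: (@Rhausdorff R) => A B At Bt'.
      have [||[a b] [/= [Aa _] [Ba _]]] := cl (A `*` setT) (B `*` setT).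
      + by exists (A, setT) => //; split => //; exact: filterT.
      + by exists (B, setT) => //; split => //; exact: filterT.
      by exists a.
    apply: hU => A B At Bt'.
    have [||[a b] [/= [_ Aa] [_ Ba]]] := cl (setT `*` A) (setT `*` B).
    + by exists (setT, A) => //; split => //; exact: filterT.
    + by exists (setT, B) => //; split => //; exact: filterT.
    by exists b.
  - apply: within_pair; first exact/continuous_subspaceT/fst_cont.
    apply: (@within_comp _ _ _ _ K snd q) => // [|z []//].
    exact/continuous_subspaceT/snd_cont.
  - apply: (@eq_within _ _ _ (fun z : R * T => q (H (1 - z.1, z.2)))).
      by move=> [t x] [/= /flip t01 Kx]; rewrite qHs.
    apply: (@within_comp _ _ _ _ K (fun z : R * T => H (1 - z.1, z.2)) q) => //.
      apply: (@within_comp _ (R * T)%type _ _ (`[0%R, 1%R] `*` K) _ H) => // -[t x].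
      by move=> [/= /flip t01 Kx].
    by move=> [t x] [/= /flip t01 Kx]; exact: HK.
split=> [t y /flip t01|y]; rewrite -qK => -[x Kx <-{y}] /=.
  by rewrite qHs//; exists (H (1 - t, x)) => //; exact: HK.
rewrite subr0 subrr Did//; last by apply: HK => //; case: (sP x Kx).
by split=> //; rewrite qHs ?in_itv /= ?lexx ?ler01// H0.
Qed.

End deformation.

(** * Collapses of geometric realizations *)

Section realization_topology.
Variables (R : realType) (V : finType).
Implicit Types (K : {set {set V}}) (s t : {set V}) (x : {ptws V -> R}).

Lemma cvg_ptws (Z : Type) (F : set_system Z) (f : Z -> {ptws V -> R})
    (l : {ptws V -> R}) : Filter F ->
  (forall v, f z v @[z --> F] --> l v) -> f @ F --> l.
Proof.
move=> FF fl; apply/cvg_sup => v; apply/cvg_image.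
  by rewrite eqEsubset; split=> // y _; exists (fun=> y).
move=> W /fl; rewrite !nbhs_simpl /= => FW.
exists (fun g : V -> R => W (g v)) => //.
by rewrite eqEsubset; split => [y [g Wg <-]//|y Wy]; exists (fun=> y).
Qed.

Lemma coord_continuous v : continuous (fun x => x v).
Proof. exact: (@proj_continuous V (fun=> R) v). Qed.

Lemma ptws_hausdorff : hausdorff_space {ptws V -> R}.
Proof. by apply: (@hausdorff_product V (fun=> R)) => _; exact: Rhausdorff. Qed.

(** For nonnegative coordinates it is positive exactly when the support contains [s], that is on the
    open star of [s]. Coordinates in a realization are at most 1, so the seed 1 leaves the minimum
    over a nonempty [s] unchanged. *)
Definition mincoord s x : R := \big[Num.min/1]_(v in s) x v.

Lemma mincoord_continuous s : continuous (mincoord s).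
Proof.
apply: continuous_big => [|v _]; last exact: coord_continuous.
exact: min_continuous.
Qed.

Lemma mincoord_le s x v : v \in s -> mincoord s x <= x v.
Proof. by move=> vs; exact: bigmin_le_cond. Qed.

Lemma mincoord_ge0 s x : (forall v, 0 <= x v) -> 0 <= mincoord s x.
Proof.
move=> x0; rewrite /mincoord; elim/big_ind : _ => // a b a0 b0.
by rewrite le_min a0.
Qed.

Lemma mincoord_gt0 s x : (forall v, v \in s -> 0 < x v) -> 0 < mincoord s x.
Proof.
move=> x0; rewrite /mincoord; elim/big_ind : _ => // a b a0 b0.
by rewrite lt_min a0.
Qed.

Lemma mincoord_attained s x : s != finset.set0 -> (forall v, x v <= 1) ->
  exists2 v, v \in s & mincoord s x = x v.
Proof.
move=> /set0Pn[w ws] x1.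
have : mincoord s x = 1 \/ exists2 v, v \in s & mincoord s x = x v.
  rewrite /mincoord; elim/big_ind : _ => [|a b|v vs]; first by left.
    by move=> Pa Pb; case: (leP a b).
  by right; exists v.
case=> // m1; exists w => //; apply/le_anti.
by rewrite mincoord_le//= m1 x1.
Qed.

Definition supp x : {set V} := finset (fun v => x v != 0).

Lemma realization_le1 K x v : realization R K x -> x v <= 1.
Proof.
move=> [x0 [x1 _]]; rewrite -x1 (bigD1 v)//= lerDl.
by apply: sumr_ge0 => w _; exact: x0.
Qed.

Lemma complex_nonempty K s : is_complex K -> s \in K -> s != finset.set0.
Proof. by move=> /forall_inP/(_ s) + sK => /(_ sK)/andP[+ _]; rewrite card_gt0. Qed.

Lemma complex_sub K s t : is_complex K -> s \in K -> t != finset.set0 ->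
  t \subset s -> t \in K.
Proof.
move=> /forall_inP/(_ s) + sK => /(_ sK)/andP[_ /forallP/(_ t)/implyP H] t0 ts.
by apply: H; rewrite card_gt0 t0.
Qed.

Lemma supp_neq0 x : \sum_v x v = 1 -> supp x != finset.set0.
Proof.
move=> x1; apply/set0Pn; apply/existsP; apply: contraT.
rewrite negb_exists => /forallP h.
have : \sum_v x v = 0.
  by apply: big1 => v _; have := h v; rewrite inE negbK => /eqP.
by rewrite x1 => /eqP; rewrite oner_eq0.
Qed.

Lemma realizationW K s x : is_complex K -> s \in K -> (forall v, 0 <= x v) ->
  \sum_v x v = 1 -> supp x \subset s -> realization R K x.
Proof.
move=> cK sK x0 x1 xs; do 2!split => //.
exact: complex_sub (supp_neq0 x1) xs.
Qed.

Lemma supp_mincoord s x : (forall v, 0 <= x v) -> 0 < mincoord s x ->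
  s \subset supp x.
Proof.
move=> x0 m0; apply/fintype.subsetP => v vs; rewrite inE gt_eqF//.
exact: lt_le_trans (mincoord_le _ vs).
Qed.

Lemma mincoord_eq0 s x : (forall v, 0 <= x v) -> ~~ (s \subset supp x) ->
  mincoord s x = 0.
Proof.
move=> x0 sx; apply/eqP; rewrite eq_le mincoord_ge0// andbT leNgt.
by apply: contra sx; exact: supp_mincoord.
Qed.

(** Having support in [K] is turned into closed conditions: [mincoord t] vanishes for every nonempty
    nonface [t]. Conversely [mincoord] of the support itself is never 0. *)
Lemma closed_realization K : is_complex K -> closed (realization R K).
Proof.
move=> cK.
rewrite (_ : realization R K =
    \bigcap_(v in [set: V]) [set x | 0 <= x v] `&`
    ((fun x => \sum_v x v) @^-1` [set 1] `&`
     \bigcap_(t in [set t : {set V} | t \notin K /\ t != finset.set0])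
       mincoord t @^-1` [set 0])).
  apply: closedI.
    apply: closed_bigI => v _;
    apply: (@preimage_closed {ptws V -> R} R (fun x => x v) [set y | 0 <= y]).
      by move=> x _; exact: coord_continuous.
    exact: closed_ge.
  apply: closedI.
    apply: preimage_closed; last exact: closed_eq.
    move=> x _; apply: (@continuous_big _ _ _ _ predT add_continuous) => v _.
    exact: coord_continuous.
  apply: closed_bigI => t _; apply: preimage_closed; last exact: closed_eq.
  by move=> x _; exact: mincoord_continuous.
apply/seteqP; split => x.
  move=> xK; have [x0 [x1 sK]] := xK; split; first by move=> v _ /=; exact: x0.
  split => // t [tK t0]; rewrite /= mincoord_eq0//.
  by apply: contra tK; exact: complex_sub.
move=> [x0 [x1 h]]; have {}x0 v : 0 <= x v by exact: x0.
split => //; split => //; rewrite -[X in X \in _]/(supp x).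
apply: contraT => sK.
have [|v] := @mincoord_attained (supp x) x (supp_neq0 x1).
  by move=> v; rewrite -x1 (bigD1 v)//= lerDl; exact: sumr_ge0.
rewrite inE (h (supp x))/= => [/eqP xv /esym/xv//|]; split => //; exact: supp_neq0.
Qed.

Lemma compact_realization K : is_complex K -> compact (realization R K).
Proof.
move=> cK; apply: (@subclosed_compact _ _
  [set x : {ptws V -> R} | forall v, `[0, 1]%classic (x v)]).
- exact: closed_realization.
- by apply: (@tychonoff V (fun=> R) (fun=> `[0, 1]%classic)) => v;
  exact: segment_compact.
- move=> x xK v; rewrite /= in_itv /= (realization_le1 _ xK) andbT.
  by case: xK.
Qed.

Definition del_star K s := [set t in K | ~~ (s \subset t)]%SET.

Lemma is_complex_del_star K s : is_complex K -> is_complex (del_star K s).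
Proof.
move=> cK; apply/forall_inP => t; rewrite inE => /andP[tK st].
rewrite card_gt0 (complex_nonempty cK tK); apply/forallP => u.
apply/implyP; rewrite card_gt0 => /andP[u0 ut]; rewrite inE.
rewrite (complex_sub cK tK u0 ut)/=.
by apply: contra st => /fintype.subset_trans; apply.
Qed.

Lemma realization_subset K1 K2 : K1 \subset K2 ->
  realization R K1 `<=` realization R K2.
Proof. by move=> /fintype.subsetP K12 x [x0 [x1 /K12]]. Qed.

Lemma del_star_sub K s : del_star K s \subset K.
Proof. by apply/fintype.subsetP => t; rewrite inE => /andP[]. Qed.

Lemma sum_indicator s : \sum_(w : V) (w \in s)%:R = #|s|%:R :> R.
Proof.
rewrite -sum1_card natr_sum [RHS]big_mkcond/=.
by apply: eq_bigr => w _; case: (w \in s).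
Qed.

(* Slides mass from the vertices of [s] to the apex [v] until one vertex of
   [s] is exhausted. *)
Definition slide s v (z : R * {ptws V -> R}) : {ptws V -> R} := fun w =>
  z.2 w + z.1 * mincoord s z.2 * (#|s|%:R *+ (w == v) - (w \in s)%:R).

Lemma coord_snd_cont v (z : R * {ptws V -> R}) :
  y.2 v @[y --> z] --> z.2 v.
Proof.
apply: (@continuous_comp _ _ _ snd (fun x : {ptws V -> R} => x v)).
  exact: snd_cont.
exact: coord_continuous.
Qed.

Lemma mincoord_snd_cont s (z : R * {ptws V -> R}) :
  mincoord s y.2 @[y --> z] --> mincoord s z.2.
Proof.
apply: (@continuous_comp _ _ _ snd (mincoord s)); first exact: snd_cont.
exact: mincoord_continuous.
Qed.

Lemma slide_continuous s v : continuous (slide s v).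
Proof.
move=> z; apply: (@cvg_ptws (R * {ptws V -> R})%type (nbhs z) (slide s v) (slide s v z)) => w.
apply: cvgD; first exact: coord_snd_cont.
apply: cvgM; last exact: cvg_cst.
by apply: cvgM; [exact: cvg_fst|exact: mincoord_snd_cont].
Qed.

(** The apex gains exactly what the #|s| vertices of [s] lose, so mass is preserved. Where something
    moves, the support contains [s], and the cone condition allows [v] to be added to it. At time 1
    a vertex realizing the minimum is emptied, so the star is left; off the star [mincoord s] is 0
    and nothing moves. *)
Lemma collapse K s v : is_complex K -> s != finset.set0 -> v \notin s ->
  (forall t, t \in K -> s \subset t -> v |: t \in K) ->
  strong_deformation_retract R (realization R K)
    (realization R (del_star K s)).
Proof.
move=> cK s0 vs cone.
have sl (t : R) x : t \in `[0%R, 1%R] -> realization R K x ->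
    realization R K (slide s v (t, x)).
  rewrite in_itv /= => /andP[t0 t1] xK; have [x0 [x1 sK]] := xK.
  have m0 := mincoord_ge0 s x0.
  have y0 w : 0 <= slide s v (t, x) w.
    rewrite /slide /=; have [ws|ws] := boolP (w \in s).
      have /negPf -> : w != v by apply: contra vs => /eqP <-.
      rewrite mulr0n sub0r mulrN1 subr_ge0.
      by rewrite (le_trans _ (mincoord_le x ws))// ler_piMl.
    by rewrite subr0 addr_ge0// mulr_ge0 ?mulr_ge0// mulrn_wge0.
  have y1 : \sum_w slide s v (t, x) w = 1.
    rewrite big_split/= x1 -mulr_sumr sumrB sum_indicator.
    rewrite (bigD1 v)//= eqxx big1 ?addr0 => [|w /negPf->//].
    by rewrite mulr1n subrr mulr0 addr0.
  have [m00|] := eqVneq (mincoord s x) 0.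
    rewrite (_ : slide s v (t, x) = x)//; apply/funext => w.
    by rewrite /slide /= m00 mulr0 mul0r addr0.
  rewrite neq_lt ltNge m0/= => m_gt0.
  apply: (@realizationW _ (v |: supp x)) => //.
    by apply: cone => //; exact: supp_mincoord.
  apply/fintype.subsetP => w; rewrite !inE; apply: contraR.
  rewrite negb_or negbK => /andP[/negPf wv /eqP xw].
  rewrite /slide /= wv xw mulr0n add0r.
  case: (boolP (w \in s)) => [ws|_]; last by rewrite subr0 mulr0.
  by have := mincoord_le x ws; rewrite leNgt xw m_gt0.
exists (slide s v); split => //.
- exact/continuous_subspaceT/slide_continuous.
- by move=> x _; apply/funext => w; rewrite /slide /= !mul0r addr0.
- move=> x xK.
  have [y0 [y1 yK]] : realization R K (slide s v (1, x)).
    by apply: sl => //; rewrite in_itv /= lexx ler01.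
  split => //; split => //; rewrite inE yK /=.
  have [w ws mw] := mincoord_attained s0 (fun v => realization_le1 v xK).
  apply/fintype.subsetPn; exists w => //; rewrite inE negbK /slide /= mw ws.
  have /negPf -> : w != v by apply: contra vs => /eqP <-.
  by rewrite mulr0n sub0r mulrN1 mul1r subrr.
- split; first exact/realization_subset/del_star_sub.
  move=> t x _ [x0 [x1]]; rewrite inE => /andP[_ sx].
  by apply/funext => w; rewrite /slide /= mincoord_eq0// mulr0 mul0r addr0.
Qed.

End realization_topology.

(** * Extending a contraction over a facet *)

Section homotopy_extension.
Variables (R : realType) (V : finType).
Implicit Types (K : {set {set V}}) (s : {set V}) (x : {ptws V -> R}).

(* With [r = 1 - #|s| * mincoord s x] the distance from the barycenter of [s]
   (scaled to be 1 on the boundary), [(ext_time, ext_point)] is the projection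
   of [(t, x)] from the point of height 2 above the barycenter onto
   [{0} x |s|] and the walls [[0, 1] x |boundary of s|]. *)
Definition ext_scale s (z : R * {ptws V -> R}) : R :=
  Num.max 2^-1 (Num.max (1 - #|s|%:R * mincoord s z.2) (1 - z.1 / 2)).

Definition ext_time s (z : R * {ptws V -> R}) : R :=
  Num.max 0 ((z.1 - 2 * #|s|%:R * mincoord s z.2) / ext_scale s z).

Definition ext_point s (z : R * {ptws V -> R}) : {ptws V -> R} := fun w =>
  (z.2 w - (1 - ext_scale s z) / #|s|%:R * (w \in s)%:R) / ext_scale s z.

(** For times in [0,1] the term 1 - t/2 is already at least 1/2; the floor 1/2 keeps the scale
    positive at all other times, so that the quotients by it are continuous on the whole product. *)
Lemma ext_scale_gt0 s z : 0 < ext_scale s z.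
Proof. by rewrite /ext_scale !lt_max invr_gt0 ltr0n. Qed.

Let fst_snd_continuous s : continuous (fun z : R * {ptws V -> R} => z.1) /\
  continuous (fun z : R * {ptws V -> R} => mincoord s z.2).
Proof.
by split; [move=> z; exact: fst_cont|move=> z; exact: mincoord_snd_cont].
Qed.

Lemma ext_scale_continuous s : continuous (ext_scale s).
Proof.
suff c (Z : topologicalType) (n : R) (f g : Z -> R) : continuous f ->
    continuous g -> continuous (fun z => Num.max 2^-1
      (Num.max (1 - n * g z) (1 - f z / 2))).
  have [c1 c2] := fst_snd_continuous s.
  exact: (c (R * {ptws V -> R})%type #|s|%:R _ _ c1 c2).
move=> cf cg; apply: (@max_fun_continuous _ Z R (cst 2^-1)).
  exact: cst_continuous.
apply: (@max_fun_continuous _ Z R (fun z => 1 - n * g z)) => z.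
  apply: cvgB; first exact: cvg_cst.
  by apply: cvgM; [exact: cvg_cst|exact: cg].
apply: cvgB; first exact: cvg_cst.
by apply: cvgM; [exact: cf|exact: cvg_cst].
Qed.

Lemma ext_time_continuous s : continuous (ext_time s).
Proof.
suff c (Z : topologicalType) (n : R) (f g r : Z -> R) : continuous f ->
    continuous g -> continuous r -> (forall z, 0 < r z) ->
    continuous (fun z => Num.max 0 ((f z - n * g z) / r z)).
  have [c1 c2] := fst_snd_continuous s.
  exact: (c (R * {ptws V -> R})%type (2 * #|s|%:R) _ _ _ c1 c2
    (@ext_scale_continuous s) (@ext_scale_gt0 s)).
move=> cf cg cr r0; apply: (@max_fun_continuous _ Z R (cst 0)).
  exact: cst_continuous.
move=> z; apply: cvgM; last by apply: cvgV; [rewrite gt_eqF|exact: cr].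
by apply: cvgB; [exact: cf|apply: cvgM; [exact: cvg_cst|exact: cg]].
Qed.

Lemma ext_point_continuous s : continuous (ext_point s).
Proof.
move=> z0; apply: (@cvg_ptws R V (R * {ptws V -> R})%type (nbhs z0)
  (ext_point s) (ext_point s z0)) => w.
suff c (Z : topologicalType) (n d : R) (f r : Z -> R) : continuous f ->
    continuous r -> (forall z, 0 < r z) ->
    continuous (fun z => (f z - (1 - r z) / n * d) / r z).
  exact: (c (R * {ptws V -> R})%type #|s|%:R (w \in s)%:R (fun z => z.2 w) _
    (@coord_snd_cont _ _ w) (@ext_scale_continuous s) (@ext_scale_gt0 s)).
move=> cf cr r0 z.
apply: cvgM; last by apply: cvgV; [rewrite gt_eqF|exact: cr].
apply: cvgB; first exact: cf.
apply: cvgM; last exact: cvg_cst.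
apply: cvgM; last exact: cvg_cst.
by apply: cvgB; [exact: cvg_cst|exact: cr].
Qed.

Lemma ext_scale_ge1 s t x : ext_scale s (t, x) = 1 ->
  ext_point s (t, x) = x.
Proof.
by move=> r1; apply/funext => w; rewrite /ext_point r1 subrr !mul0r subr0 divr1.
Qed.

(** The projected pair is fed to [extend0 H]: a pair landing on the floor has time 0 and keeps its
    point, a pair landing on a wall lies over [del_star K s], where [H] is available. Over
    [del_star K s] the projection is the identity, so the new homotopy extends [H]. *)
Lemma contracts_in_add_facet K s (L : set {ptws V -> R}) e :
  is_complex K -> s \in K -> (forall t, t \in K -> s \subset t -> t = s) ->
  L `<=` realization R (del_star K s) ->
  contracts_in R (realization R (del_star K s)) L e ->
  contracts_in R (realization R K) L e.
Proof.
move=> cK sK smax LK [H [cH HK H0 HL He]].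
have s0 := complex_nonempty cK sK.
have n_gt0 : 0 < #|s|%:R :> R by rewrite ltr0n card_gt0.
have K0K := @realization_subset R _ _ _ (del_star_sub K s).
have i1 : (1 : R) \in `[0%R, 1%R] by rewrite in_itv /= ler01 lexx.
have nm0 x : realization R K x -> 0 <= #|s|%:R * mincoord s x.
  by move=> [x0 _]; rewrite mulr_ge0// mincoord_ge0.
have nm1 x : realization R K x -> #|s|%:R * mincoord s x <= 1.
  move=> [x0 [x1 _]]; rewrite -[leRHS]x1 (bigID (mem s))/= ler_wpDr ?sumr_ge0//.
  rewrite mulr_natl -sumr_const; apply: ler_sum => v.
  exact: mincoord_le.
have scale1 t x : t \in `[0%R, 1%R] -> realization R K x ->
    ext_scale s (t, x) <= 1.
  rewrite in_itv /= => /andP[t0 t1] /nm0 ?; rewrite /ext_scale /=.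
  by rewrite !ge_max; apply/and3P; split; lra.
have scaleL t x : t \in `[0%R, 1%R] -> realization R (del_star K s) x ->
    ext_scale s (t, x) = 1 /\ ext_time s (t, x) = t.
  rewrite in_itv /= => /andP[t0 t1] [x0 [_]]; rewrite inE => /andP[_ sx].
  have sc1 : ext_scale s (t, x) = 1.
    rewrite /ext_scale /= mincoord_eq0// mulr0 subr0.
    by rewrite (@max_l _ _ 1) ?max_r//; lra.
  by rewrite /ext_time sc1 /= mincoord_eq0// !mulr0 subr0 divr1 max_r.
have scale0 x : realization R K x ->
    ext_scale s (0, x) = 1 /\ ext_time s (0, x) = 0.
  move=> xK; have := nm0 x xK; have := nm1 x xK => nm1x nm0x; split.
    rewrite /ext_scale /= mul0r subr0 (@max_r _ _ _ 1) ?max_r//; lra.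
  rewrite /ext_time max_l//= pmulr_lle0 ?invr_gt0 ?ext_scale_gt0//.
  lra.
have ptK t x : t \in `[0%R, 1%R] -> realization R K x ->
    realization R K (ext_point s (t, x)).
  move=> t01 xK; have [x0 [x1 suppK]] := xK.
  have r_gt0 := ext_scale_gt0 s (t, x); have r1 := scale1 t x t01 xK.
  (* The multiple of the barycenter that [ext_point] subtracts is at most the smallest coordinate on
     [s], so no coordinate becomes negative. *)
  have rm : (1 - ext_scale s (t, x)) / #|s|%:R <= mincoord s x.
    rewrite ler_pdivrMr// mulrC lerBlDr -lerBlDl /ext_scale.
    by rewrite !le_max lexx !orbT.
  have y1 : \sum_w ext_point s (t, x) w = 1.
    rewrite -mulr_suml sumrB x1 -mulr_sumr sum_indicator.
    by rewrite divfK ?gt_eqF// opprB addrC subrK divff ?gt_eqF.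
  apply: (@realizationW _ _ _ (supp x)) => //.
    move=> w; rewrite divr_ge0 ?(ltW r_gt0)// subr_ge0 /=.
    case: (boolP (w \in s)) => [ws|_]; last by rewrite mulr0.
    by rewrite mulr1 (le_trans rm)// mincoord_le.
  apply/fintype.subsetP => w; rewrite !inE; apply: contraNneq => xw0.
  rewrite /ext_point /= xw0 sub0r.
  case: (boolP (w \in s)) => [ws|_]; last by rewrite mulr0 oppr0 mul0r.
  have m0 : mincoord s x = 0.
    by apply/le_anti; rewrite mincoord_ge0// andbT -xw0 mincoord_le.
  have -> : ext_scale s (t, x) = 1.
    apply/le_anti; rewrite r1 /ext_scale /= m0 mulr0 subr0.
    by rewrite !le_max lexx !orbT.
  by rewrite subrr !mul0r oppr0 mul0r.
have tauP t x : t \in `[0%R, 1%R] -> realization R K x ->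
    ext_time s (t, x) = 0 \/ ext_time s (t, x) \in `[0%R, 1%R] /\
      realization R (del_star K s) (ext_point s (t, x)).
  move=> t01 xK; have [y0 [y1 yK]] := ptK t x t01 xK.
  have := t01; rewrite in_itv /= => /andP[t0 t1].
  have nmx0 := nm0 x xK; have nmx1 := nm1 x xK.
  have r_gt0 := ext_scale_gt0 s (t, x).
  (* Decides whether the ray from the projection centre leaves the prism through the floor or
     through a wall; equality is the common edge. *)
  case: (leP t (2 * #|s|%:R * mincoord s x)) => tm; [left|right].
    rewrite /ext_time max_l//= pmulr_lle0 ?invr_gt0//; lra.
  have r : ext_scale s (t, x) = 1 - #|s|%:R * mincoord s x.
    rewrite /ext_scale /= (@max_l _ _ (1 - #|s|%:R * mincoord s x)); last by lra.
    by rewrite max_r//; lra.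
  split.
    rewrite in_itv /= /ext_time le_max lexx /= ge_max ler01 /= ler_pdivrMr//.
    by rewrite r mul1r; lra.
  split => //; split => //; rewrite inE yK /=.
  have [v vs mv] := mincoord_attained s0 (fun v => realization_le1 v xK).
  apply/fintype.subsetPn; exists v => //; rewrite inE negbK /ext_point /= r vs.
  rewrite subKr mulr1 mulrAC divff ?(lt0r_neq0 n_gt0)// mul1r mv subrr.
  by rewrite mul0r.
exists (fun z => extend0 H (ext_time s z, ext_point s z)); split.
- apply: (@extend0_within R _ _ _ _ (realization R (del_star K s))) => //.
  + exact/closed_realization/is_complex_del_star.
  + exact/continuous_subspaceT/ext_time_continuous.
  + exact/continuous_subspaceT/ext_point_continuous.
  + by move=> [t x] [/= t01 xK]; exact: tauP.
- move=> t x t01 xK; rewrite /extend0 /=; case: ifP => [_|/eqP tau0].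
    exact: ptK.
  by case: (tauP t x t01 xK) => [//|[tau01 pK]]; exact/K0K/HK.
- move=> x xK; have [r tau] := scale0 x xK.
  by rewrite /extend0 /= tau eqxx ext_scale_ge1.
- move=> t x t01 xL; have [r tau] := scaleL t x t01 (LK x xL).
  rewrite tau ext_scale_ge1// /extend0 /=; case: ifP => // _.
  exact: HL.
- move=> x xL; have [r tau] := scaleL 1 x i1 (LK x xL).
  by rewrite tau ext_scale_ge1// /extend0 /= oner_eq0 He.
Qed.

End homotopy_extension.

(** * Mapping facets to spheres *)

Section bubbles.
Variables (R : realType) (V : finType) (v0 : V).
Implicit Types (K : {set {set V}}) (s : {set V}) (x : {ptws V -> R}).

(** Expanding the square exhibits the sphere as passing through the origin. For k > 0 all its other
    points have positive first coordinate, and k can be recovered from any of them. *)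
Lemma sphere_through0 (y : 'I_4 -> R) (k : R) :
  \sum_(i < 4) (y i - (if i == ord0 then k else 0)) ^+ 2 = k ^+ 2 <->
  \sum_(i < 4) y i ^+ 2 = 2 * k * y ord0.
Proof.
rewrite (bigD1 ord0)//= [in X in _ <-> X](bigD1 ord0)//=.
rewrite (eq_bigr (fun i => y i ^+ 2)) => [|i /negPf->]; last by rewrite subr0.
set S := \sum_(i < 4 | _) _.
by split=> h; nra.
Qed.

Definition vtx s (i : nat) : V := nth v0 (enum s) i.

Lemma vtx_in s i : (i < #|s|)%N -> vtx s i \in s.
Proof. by move=> si; rewrite -mem_enum mem_nth// -cardE. Qed.

Lemma sum_vtx s (F : V -> R) : #|s| = 4%N ->
  \sum_(v in s) F v = \sum_(i < 4) F (vtx s i).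
Proof.
move=> s4; rewrite -[LHS]big_enum /= (big_nth v0) -cardE s4.
by rewrite big_mkord.
Qed.

Lemma vtx_onto s v : #|s| = 4%N -> v \in s ->
  exists2 i : 'I_4, v = vtx s i & index v (enum s) = i.
Proof.
move=> s4 vs; have iv : (index v (enum s) < 4)%N.
  by rewrite -s4 cardE index_mem mem_enum.
by exists (Ordinal iv) => //; rewrite /vtx nth_index// mem_enum.
Qed.

(* On the open simplex [s], [bubble s] is the inverse stereographic projection
   of [(x_i - x_0) / mincoord s x], written so that it extends by 0. *)
Definition bubble_dir s x (i : 'I_4) : R :=
  if i == ord0 then mincoord s x else x (vtx s i) - x (vtx s 0).

(** On the simplex [s] the last square is 0 and the squared norm of the direction remains. Elsewhere
    it keeps the denominator positive when the direction vanishes, which forces all coordinates on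
    [s] to be 0. *)
Definition bubble_den s x : R :=
  \sum_(i < 4) bubble_dir s x i ^+ 2 + (1 - \sum_(v in s) x v) ^+ 2.

(** On the open simplex this is the second intersection of the line through the origin and
    [bubble_dir s x] with the unit sphere centred at (1,0,0,0). *)
Definition bubble s x : {ptws 'I_4 -> R} := fun i =>
  2 * mincoord s x * bubble_dir s x i / bubble_den s x.

Lemma bubble_den_gt0 s x : #|s| = 4%N -> 0 < bubble_den s x.
Proof.
move=> s4; rewrite lt_neqAle addr_ge0 ?sumr_ge0 ?sqr_ge0// => [|i _]; last first.
  exact: sqr_ge0.
rewrite andbT eq_sym /bubble_den paddr_eq0 ?sqr_ge0 ?sumr_ge0// => [|i _]; last first.
  exact: sqr_ge0.
rewrite psumr_eq0 => [|i _]; last exact: sqr_ge0.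
apply/negP => /andP[/allP d0]; rewrite sqrf_eq0 subr_eq0 => /eqP s1.
have {}d0 i : bubble_dir s x i = 0.
  by have := d0 i; rewrite mem_index_enum sqrf_eq0 => /(_ isT)/eqP.
have m0 : mincoord s x = 0 by rewrite -(d0 ord0).
have xs v : v \in s -> x v = x (vtx s 0).
  move=> /(vtx_onto s4)[i -> _]; have := d0 i; rewrite /bubble_dir.
  by case: eqP => [->//|_ /eqP]; rewrite subr_eq0 => /eqP.
have [x0|x0] := ltP 0 (x (vtx s 0)).
  have : 0 < mincoord s x by apply: mincoord_gt0 => v /xs ->.
  by rewrite m0 ltxx.
have x00 : x (vtx s 0) = 0.
  by apply/le_anti; rewrite x0 -m0 mincoord_le// vtx_in// s4.
by move: s1; rewrite big1 => [/eqP|v /xs ->//]; rewrite oner_eq0.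
Qed.

Lemma bubble_continuous s : #|s| = 4%N -> continuous (bubble s).
Proof.
move=> s4 x; apply: (@cvg_ptws R _ {ptws V -> R} (nbhs x)
  (bubble s) (bubble s x)) => i.
have cc v : continuous (fun x : {ptws V -> R} => x v).
  exact: coord_continuous.
have cm : continuous (mincoord s : {ptws V -> R} -> R).
  exact: mincoord_continuous.
have cd j : continuous (bubble_dir s ^~ j).
  rewrite /bubble_dir; case: (j == ord0); first exact: cm.
  suff cB (Z : topologicalType) (f g : Z -> R) : continuous f -> continuous g ->
      continuous (fun z => f z - g z).
    exact: (cB {ptws V -> R} _ _ (cc _) (cc _)).
  by move=> cf cg z; apply: cvgB; [exact: cf|exact: cg].
suff c (Z : topologicalType) (m S : Z -> R) (d : 'I_4 -> Z -> R) : continuous m ->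
    continuous S -> (forall j, continuous (d j)) ->
    (forall z, 0 < \sum_j d j z ^+ 2 + (1 - S z) ^+ 2) ->
    continuous (fun z => 2 * m z * d i z /
      (\sum_j d j z ^+ 2 + (1 - S z) ^+ 2)).
  apply: (c {ptws V -> R} _ (fun x => \sum_(v in s) x v)
    (fun j => bubble_dir s ^~ j)) => //.
    by apply: (@continuous_big _ _ _ _ (mem s) add_continuous).
  by move=> z; exact: bubble_den_gt0.
move=> {cd cm cc} cm cS cd den0 z; apply: cvgM.
  apply: cvgM; last exact: cd.
  by apply: cvgM; [exact: cvg_cst|exact: cm].
apply: cvgV; first by rewrite gt_eqF.
apply: cvgD.
  apply: cvg_big => [|j _]; first exact: add_continuous.
  by apply: cvgM; exact: cd.
by apply: cvgM; apply: cvgB; (exact: cvg_cst || exact: cS).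
Qed.

Lemma bubble0 s x : mincoord s x = 0 -> bubble s x = fun=> 0.
Proof. by move=> m0; apply/funext => i; rewrite /bubble m0 mulr0 !mul0r. Qed.

Section one_bubble.
Variables (s : {set V}) (x : {ptws V -> R}).
Hypotheses (s4 : #|s| = 4%N) (s1 : \sum_(v in s) x v = 1)
  (m_gt0 : 0 < mincoord s x).

Lemma bubble_norm :
  \sum_i bubble s x i ^+ 2 = 2 * bubble s x ord0 /\ 0 < bubble s x ord0.
Proof.
have D0 := bubble_den_gt0 x s4; split; last first.
  by rewrite /bubble /bubble_dir eqxx !mulr_gt0// invr_gt0.
rewrite /bubble.
under eq_bigr do rewrite -mulrA exprMn mulrC exprMn mulrAC.
rewrite -!mulr_suml.
have -> : \sum_i bubble_dir s x i ^+ 2 = bubble_den s x.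
  by rewrite /bubble_den s1 subrr expr0n addr0.
rewrite /bubble_dir eqxx.
by field; rewrite gt_eqF.
Qed.

Lemma bubble_dirE i :
  bubble_dir s x i * bubble s x ord0 = mincoord s x * bubble s x i.
Proof. by rewrite /bubble {2}/bubble_dir eqxx; ring. Qed.

End one_bubble.

(** Equal bubbles have proportional directions, so the minimum of [y] times [x] differs on [s] from
    the minimum of [x] times [y] by a constant [c]. At a vertex where [x] is minimal this gives c <=
    0, where [y] is minimal c >= 0. Hence [x] and [y] are proportional on [s], and their equal mass
    makes them agree there. *)
Lemma bubble_inj s x y : #|s| = 4%N ->
  \sum_(v in s) x v = 1 -> \sum_(v in s) y v = 1 ->
  0 < mincoord s x -> 0 < mincoord s y ->
  (forall v, x v <= 1) -> (forall v, y v <= 1) ->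
  bubble s x = bubble s y -> forall v, v \in s -> x v = y v.
Proof.
move=> s4 x1 y1 mx my xle yle bxy.
have s0 : s != finset.set0 by rewrite -card_gt0 s4.
have [_ b0] := bubble_norm s4 x1 mx.
have dxy i : mincoord s y * bubble_dir s x i = mincoord s x * bubble_dir s y i.
  apply: (mulIf (lt0r_neq0 b0)).
  rewrite -mulrA (bubble_dirE s x i) {2}bxy -mulrA bxy (bubble_dirE s y i).
  by ring.
pose c := mincoord s y * x (vtx s 0) - mincoord s x * y (vtx s 0).
have xyc v : v \in s -> mincoord s y * x v = mincoord s x * y v + c.
  move=> /(vtx_onto s4)[i -> _]; have := dxy i; rewrite /bubble_dir /c.
  case: eqP => [-> _|_]; first by rewrite addrC subrK.
  by move=> h; lra.
have c0 : c = 0.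
  apply/le_anti/andP; split.
    have [v vs mv] := mincoord_attained s0 xle.
    have := xyc v vs; have := mincoord_le y vs.
    rewrite -mv; move: (mincoord s x) (mincoord s y) mx my => a b a0 b0'.
    by move=> h1 h2; nra.
  have [v vs mv] := mincoord_attained s0 yle.
  have := xyc v vs; have := mincoord_le x vs.
  rewrite -mv; move: (mincoord s x) (mincoord s y) mx my => a b a0 b0'.
  by move=> h1 h2; nra.
have mxy : mincoord s x = mincoord s y.
  have : mincoord s y * \sum_(v in s) x v = mincoord s x * \sum_(v in s) y v.
    rewrite !mulr_sumr; apply: eq_bigr => v /xyc ->.
    by rewrite c0 addr0.
  by rewrite x1 y1 !mulr1.
move=> v /xyc; rewrite c0 addr0 mxy.
by apply: mulfI; exact: lt0r_neq0.
Qed.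

Lemma bubble_onto s (y : 'I_4 -> R) : #|s| = 4%N ->
  \sum_i y i ^+ 2 = 2 * y ord0 -> 0 < y ord0 ->
  exists x, [/\ forall v, 0 <= x v, \sum_v x v = 1, supp x = s,
    \sum_(v in s) x v = 1 & 0 < mincoord s x] /\ bubble s x = y.
Proof.
move=> s4 y2 y0.
(* Stereographic coordinates of [y]: the required values of (x_i - x_0) / [mincoord s x]. *)
pose u (i : 'I_4) := if i == ord0 then 0 else y i / y ord0.
(* The seed 0 is the value of [u] at index 0, so this is the true minimum. With it subtracted, 1 +
   (u_i - mu) has minimum 1, and dividing by the total [T] gives mass 1 and minimum [m]. *)
pose mu := \big[Num.min/0]_(i < 4) u i.
have muu i : mu <= u i by exact: bigmin_le_cond.
pose T := \sum_(i < 4) (1 + (u i - mu)).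
(* Ensures m <= 1, as the seed 1 in [mincoord] demands. *)
have T4 : 1 <= T.
  rewrite /T (bigD1 ord0)//= -[leLHS]addr0 lerD//.
    by rewrite lerDl subr_ge0.
  by apply: sumr_ge0 => i _; rewrite addr_ge0// subr_ge0.
have T0 : 0 < T by exact: lt_le_trans T4.
pose m := T^-1.
have m0 : 0 < m by rewrite invr_gt0.
pose x : {ptws V -> R} := fun v =>
  if v \in s then m * (1 + (u (inord (index v (enum s))) - mu)) else 0.
have xv (i : 'I_4) : x (vtx s i) = m * (1 + (u i - mu)).
  rewrite /x vtx_in ?s4// /vtx index_uniq ?enum_uniq// -?cardE ?s4//.
  by rewrite inord_val.
have xge v : v \in s -> m <= x v.
  move=> /(vtx_onto s4)[i -> _].
  by rewrite xv ler_peMr ?(ltW m0)// lerDl subr_ge0.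
have xm : mincoord s x = m.
  apply/le_anti/andP; split; last first.
    apply: le_bigmin => //; by rewrite /m invf_le1.
  have [i mui] : exists i : 'I_4, u i = mu.
    have : mu = 0 \/ exists i : 'I_4, u i = mu.
      rewrite /mu; elim/big_ind : _ => [|a b|i _]; first by left.
        by move=> Pa Pb; case: (leP a b).
      by right; exists i.
    by case=> // ->; exists ord0.
  have := @mincoord_le R V s x (vtx s i); rewrite xv mui subrr addr0 mulr1.
  by apply; rewrite vtx_in// s4.
have xs1 : \sum_(v in s) x v = 1.
  rewrite sum_vtx//; under eq_bigr do rewrite xv.
  by rewrite -mulr_sumr mulVf// gt_eqF.
exists x; split; first split => //.
- move=> v; have [vs|vs] := boolP (v \in s); last by rewrite /x (negPf vs).
  exact: le_trans (ltW m0) (xge v vs).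
- by rewrite -xs1 [RHS]big_mkcond; apply: eq_bigr => v _; rewrite /x; case: ifP.
- apply/setP => v; rewrite inE.
  have [vs|vs] := boolP (v \in s); last by rewrite /x (negPf vs) eqxx.
  by rewrite gt_eqF//; exact: lt_le_trans (xge v vs).
- by rewrite xm.
have dE i : bubble_dir s x i = m / y ord0 * y i.
  rewrite /bubble_dir; case: eqP => [->|/eqP/negPf i0].
    by rewrite xm divfK// gt_eqF.
  rewrite xv (xv ord0) /u i0 eqxx.
  by ring.
apply/funext => i; rewrite /bubble /bubble_den xs1 subrr expr0n addr0 xm dE.
under eq_bigr do rewrite dE exprMn.
rewrite -mulr_sumr y2.
by field; rewrite !gt_eqF.
Qed.

End bubbles.

(** * The quotient map from a complex with marked facets onto the bouquet *)

Section wedge.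
Variables (R : realType) (V : finType).
Implicit Types (K : {set {set V}}) (s : {set V}) (x : {ptws V -> R})
  (F : seq {set V}).

Definition del_facets K F := [set t in K | t \notin F]%SET.

Lemma del_star_facet K s :
  (forall t, t \in K -> s \subset t -> t = s) ->
  del_star K s = del_facets K [:: s].
Proof.
move=> smax; apply/setP => t; rewrite !inE; case tK : (t \in K) => //=.
by congr (~~ _); apply/idP/eqP => [/(smax _ tK)|->//].
Qed.

Lemma contracts_in_add_facets K F (L : set {ptws V -> R}) e :
  is_complex K -> uniq F ->
  (forall s, s \in F -> s \in K /\ forall t, t \in K -> s \subset t -> t = s) ->
  L `<=` realization R (del_facets K F) ->
  contracts_in R (realization R (del_facets K F)) L e ->
  contracts_in R (realization R K) L e.
Proof.
elim: F K => [|s F IH] K cK.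
  move=> _ _; suff -> : del_facets K [::] = K by [].
  by apply/setP => t; rewrite inE andbT.
move=> /andP[sF uF] FK.
have [sK smax] : s \in K /\ forall t, t \in K -> s \subset t -> t = s.
  by apply: FK; rewrite mem_head.
have -> : del_facets K (s :: F) = del_facets (del_star K s) F.
  by rewrite (del_star_facet smax); apply/setP => t; rewrite !inE negb_or andbA.
move=> LK cL; apply: (contracts_in_add_facet cK sK smax).
  apply: subset_trans LK _; apply: realization_subset.
  by apply/fintype.subsetP => t; rewrite inE => /andP[].
apply: IH => //; first exact: is_complex_del_star.
move=> t tF; have [tK tmax] : t \in K /\ forall u, u \in K -> t \subset u -> u = t.
  by apply: FK; rewrite inE tF orbT.
split; first rewrite inE tK /=.
  by apply: contra sF => /(smax _ tK) <-.
by move=> u; rewrite inE => /andP[uK _]; exact: tmax.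
Qed.

(** The k-th summand vanishes off the open star of the k-th facet, so for distinct facets at most
    one summand is nonzero at a point of the complex; the factor k + 1 enlarges the unit sphere to
    radius k + 1. *)
Definition bouquet v0 F x : {ptws 'I_4 -> R} := fun i =>
  \sum_(k < size F) k.+1%:R * bubble v0 (nth finset.set0 F k) x i.

Lemma bouquet_continuous v0 F : (forall s, s \in F -> #|s| = 4%N) ->
  continuous (bouquet v0 F).
Proof.
move=> F4 x; apply: (@cvg_ptws R _ {ptws V -> R} (nbhs x)
  (bouquet v0 F) (bouquet v0 F x)) => i.
suff c (Z : topologicalType) (b : 'I_(size F) -> Z -> R) :
    (forall k, continuous (b k)) ->
    continuous (fun z => \sum_(k < size F) k.+1%:R * b k z).
  apply: (c {ptws V -> R} (fun k x => bubble v0 (nth finset.set0 F k) x i)) => k z.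
  apply: (@continuous_comp _ _ _ (bubble v0 (nth finset.set0 F k))
    (fun y : {ptws 'I_4 -> R} => y i)).
    by apply: bubble_continuous; apply: F4; exact: mem_nth.
  exact: coord_continuous.
move=> cb z; apply: cvg_big => [|k _]; first exact: add_continuous.
by apply: cvgM; [exact: cvg_cst|exact: cb].
Qed.

Theorem wedge_of_facets (K K1 : {set {set V}}) F (e : {ptws V -> R}) :
  is_complex K1 -> uniq F -> (0 < size F)%N ->
  (forall s, s \in F ->
    [/\ s \in K1, #|s| = 4%N & forall t, t \in K1 -> s \subset t -> t = s]) ->
  strong_deformation_retract R (realization R K) (realization R K1) ->
  strong_deformation_retract R (realization R (del_facets K1 F)) [set e] ->
  homotopy_equivalent R (realization R K) (wedge_S3 R (size F)).
Proof.
move=> cK1 uF F0 FK1 KK1 [H [cH HL H0 H1 [eL _]]].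
have F4 s : s \in F -> #|s| = 4%N by case/FK1.
have [v0 _] : exists v0 : V, v0 \in nth finset.set0 F 0.
  by apply/card_gt0P; rewrite F4// mem_nth.
have nF (k : 'I_(size F)) : nth finset.set0 F k \in F by exact: mem_nth.
have LK1 : realization R (del_facets K1 F) `<=` realization R K1.
  by apply: realization_subset; apply/fintype.subsetP => t; rewrite inE => /andP[].
pose q := bouquet v0 F.
have qL x : realization R (del_facets K1 F) x -> q x = fun=> 0.
  move=> [x0 [x1]]; rewrite inE => /andP[xK xF].
  apply/funext => i; rewrite /q /bouquet big1// => k _.
  rewrite bubble0 ?mulr0// mincoord_eq0//; apply: contra xF => sx.
  by have [_ _ smax] := FK1 _ (nF k); rewrite (smax _ xK sx).
have qF x (k : 'I_(size F)) : (forall v, 0 <= x v) ->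
    supp x = nth finset.set0 F k ->
    q x = fun i => k.+1%:R * bubble v0 (nth finset.set0 F k) x i.
  move=> x0 xk; apply/funext => i.
  rewrite /q /bouquet (bigD1 k)//= big1 ?addr0// => j jk.
  rewrite bubble0 ?mulr0// mincoord_eq0//; apply: contra jk => sx.
  have [_ _ smax] := FK1 _ (nF j); have [kK _ _] := FK1 _ (nF k).
  move: sx; rewrite xk => /(smax _ kK)/eqP.
  by rewrite nth_uniq// => /eqP kj; apply/eqP/val_inj.
have K1P x : realization R K1 x -> realization R (del_facets K1 F) x \/
    exists k : 'I_(size F), [/\ supp x = nth finset.set0 F k,
      \sum_(v in nth finset.set0 F k) x v = 1 &
      0 < mincoord (nth finset.set0 F k) x].
  move=> [x0 [x1 xK]]; have [xF|xF] := boolP (supp x \in F); last first.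
    by left; split => //; split => //; rewrite inE xK.
  right; have sx : (index (supp x) F < size F)%N by rewrite index_mem.
  exists (Ordinal sx); rewrite /= nth_index//; split => //.
    rewrite big_mkcond -[RHS]x1; apply: eq_bigr => v _; rewrite inE.
    by case: eqP.
  by apply: mincoord_gt0 => v; rewrite inE lt_neqAle x0 eq_sym andbT.
have qS x (k : 'I_(size F)) : (forall v, 0 <= x v) ->
    supp x = nth finset.set0 F k ->
    \sum_(v in nth finset.set0 F k) x v = 1 ->
    0 < mincoord (nth finset.set0 F k) x ->
    \sum_i q x i ^+ 2 = 2 * k.+1%:R * q x ord0 /\ 0 < q x ord0.
  move=> x0 xk s1 m0; have [b2 b0] := bubble_norm v0 (F4 _ (nF k)) s1 m0.
  rewrite (qF _ _ x0 xk); split; last by rewrite mulr_gt0// ltr0n.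
  under eq_bigr do rewrite exprMn.
  by rewrite -mulr_sumr b2; ring.
apply: (@quotient_homotopy_equivalent R {ptws V -> R} {ptws 'I_4 -> R} _
  (realization R K1) (realization R (del_facets K1 F)) _ q e (fun=> 0)) => //.
- exact: ptws_hausdorff.
- exact: closed_realization.
- exact: compact_realization.
- apply: (@contracts_in_add_facets K1 F) => //.
    by move=> s /FK1[].
  by exists H; split.
- by apply: continuous_subspaceT; exact: bouquet_continuous.
- apply/seteqP; split => [_ [x xK <-]|y [k k1n /sphere_through0 yS]].
    have [xL|[k [xk s1 m0]]] := K1P x xK.
      (* The remainder goes to the origin, which lies on every sphere; the first one exists because
         [F] is nonempty. *)
      exists 1%N => //; apply/sphere_through0.
      rewrite (qL _ xL) mulr0 big1// => i _; exact: expr0n.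
    exists k.+1; first by rewrite /= ltn_ord.
    have [x0 _] := xK.
    by apply/sphere_through0; have [] := qS x k x0 xk s1 m0.
  have y2 : 0 <= \sum_i y i ^+ 2 by apply: sumr_ge0 => i _; exact: sqr_ge0.
  have k0 : 0 < k%:R :> R by rewrite ltr0n; case/andP: k1n.
  (* A point of the k-th sphere with nonpositive first coordinate has squared norm 2 k y_0 <= 0, so
     it is the origin, the image of [e]. *)
  have [y0|y0] := ltP 0 (y ord0); last first.
    exists e; first by apply: LK1; exact: eL.
    have y20 : \sum_i y i ^+ 2 = 0.
      by apply/le_anti; rewrite y2 yS andbT pmulr_rle0// mulr_gt0.
    rewrite qL; last exact: eL.
    apply/funext => i; have/eqP := y20.
    rewrite psumr_eq0 => [|j _]; last exact: sqr_ge0.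
    by move=> /allP/(_ i); rewrite mem_index_enum sqrf_eq0 => /(_ isT)/eqP.
  case: k k1n k0 yS => // k /= kn k0 yS; pose kk := Ordinal kn.
  have [x [[x0 x1 xk s1 m0] xy]] :
      exists x, [/\ forall v, 0 <= x v, \sum_v x v = 1,
        supp x = nth finset.set0 F kk,
        \sum_(v in nth finset.set0 F kk) x v = 1 &
        0 < mincoord (nth finset.set0 F kk) x] /\
      bubble v0 (nth finset.set0 F kk) x = (fun i => y i / k.+1%:R).
    apply: bubble_onto; first exact/F4/nF.
      under eq_bigr do rewrite expr_div_n.
      by rewrite -mulr_suml yS; field; rewrite gt_eqF.
    by rewrite divr_gt0.
  exists x.
    split => //; split => //; rewrite -[X in X \in _]/(supp x) xk.
    by case: (FK1 _ (nF kk)).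
  rewrite (qF x kk)// xy; apply/funext => i /=.
  by rewrite mulrC divfK// gt_eqF.
- move=> x y xK yK qxy; have [x0 [x1 _]] := xK; have [y0 [y1 _]] := yK.
  have [xL|[k [xk xs1 xm]]] := K1P x xK; have [yL|[l [yl ys1 ym]]] := K1P y yK.
  + by right.
  + have [_] := qS y l y0 yl ys1 ym; by rewrite -qxy (qL _ xL) ltxx.
  + have [_] := qS x k x0 xk xs1 xm; by rewrite qxy (qL _ yL) ltxx.
  have [x2 q0] := qS x k x0 xk xs1 xm; have [y2 _] := qS y l y0 yl ys1 ym.
  (* Away from the origin the radius is the squared norm divided by twice the first coordinate, so
     the common image determines the facet. *)
  have kl : k = l.
    move: x2; rewrite qxy y2 => /(mulIf _); rewrite -qxy => /(_ (lt0r_neq0 q0)).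
    move=> /mulfI; rewrite pnatr_eq0 => /(_ isT)/eqP; rewrite eqr_nat eqSS.
    by move=> /eqP lk; apply/val_inj.
  left; apply/funext => v; subst l.
  have [vs|vs] := boolP (v \in nth finset.set0 F k); last first.
    have := vs; rewrite -{1}xk inE negbK => /eqP ->.
    by move: vs; rewrite -{1}yl inE negbK => /eqP ->.
  apply: (@bubble_inj _ _ v0 (nth finset.set0 F k)) => //; first exact/F4/nF.
  + by move=> w; exact: realization_le1 xK.
  + by move=> w; exact: realization_le1 yK.
  apply/funext => i; have := congr1 (fun f => f i) qxy.
  rewrite (qF _ _ x0 xk) (qF _ _ y0 yl) => /mulfI; apply.
  by rewrite pnatr_eq0.
Qed.

End wedge.

(** * Complexes encoded by bit sequences *)

(* A simplex on the vertices [vs] is encoded by its characteristic bit sequence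
   along [vs], so that collapses can be checked by evaluation. *)
Section bit_complexes.
Variables (V : finType) (vs : seq V).
Hypothesis vs_uniq : uniq vs.
Implicit Types (b c s : bitseq) (l : seq bitseq).

Definition dec b : {set V} :=
  finset (fun v => (v \in vs) && nth false b (index v vs)).

Definition cset l : {set {set V}} := finset (fun A => A \in map dec l).

Fixpoint subb b c : bool :=
  match b with
  | [::] => true
  | x :: b' => if x then (if c is true :: c' then subb b' c' else false)
               else subb b' (behead c)
  end.

Lemma subbP b c :
  reflect (forall i, nth false b i -> nth false c i) (subb b c).
Proof.
apply: (iffP idP).
  elim: b c => [|[] b IH] [|[] c] //= h [|i] //= bi; try exact: IH bi.
  by have := IH _ h _ bi; rewrite nth_nil.
elim: b c => [//|x b IH] c h; case: x h => [|] h /=.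
  case: c h => [|[] c] h; [by have := h 0%N isT| |by have := h 0%N isT].
  by apply: IH => i; exact: (h i.+1).
by apply: IH => i /(h i.+1); rewrite nth_behead.
Qed.

Lemma index_onto i : (i < size vs)%N -> exists2 v, v \in vs & index v vs = i.
Proof.
move=> ivs; have [v0 _] : exists v0, v0 \in vs.
  by case: vs ivs => // v0 ? _; exists v0; rewrite mem_head.
by exists (nth v0 vs i); [exact: mem_nth|exact: index_uniq].
Qed.

Lemma index_vs_inj v w : v \in vs -> w \in vs -> index v vs = index w vs ->
  v = w.
Proof. by move=> vvs wvs vw; rewrite -(nth_index v vvs) vw nth_index. Qed.

Lemma dec_sub b c : subb b c -> dec b \subset dec c.
Proof.
move=> /subbP bc; apply/fintype.subsetP => v; rewrite !inE => /andP[-> /=].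
exact: bc.
Qed.

Lemma sub_dec b c : size b = size vs -> dec b \subset dec c -> subb b c.
Proof.
move=> sb /fintype.subsetP bc; apply/subbP => i bi.
have ivs : (i < size vs)%N.
  by rewrite -sb ltnNge; apply/negP => ib; rewrite nth_default in bi.
have [v vvs vi] := index_onto ivs.
by have := bc v; rewrite !inE vvs vi bi => /(_ isT).
Qed.

Lemma dec_bits_inj : {in [pred b | size b == size vs] &, injective dec}.
Proof.
move=> b c; rewrite !inE => /eqP sb /eqP sc bc.
apply: (@eq_from_nth _ false) => [|i _]; first by rewrite sb.
by apply/idP/idP; apply/subbP; apply: sub_dec => //; rewrite bc.
Qed.

Lemma card_dec b : size b = size vs -> #|dec b| = count id b.
Proof.
move=> sb; have E : mask b vs =i dec b.
  move=> v; rewrite inE; case vvs : (v \in vs); last first.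
    by apply/negP => /mem_mask; rewrite vvs.
  by rewrite in_mask// vvs.
by rewrite -(eq_card E) (card_uniqP (mask_uniq vs_uniq _)) size_mask.
Qed.

Lemma mem_cset b l : b \in l -> dec b \in cset l.
Proof. by move=> bl; rewrite inE map_f. Qed.

Lemma csetP A l : reflect (exists2 b, b \in l & A = dec b) (A \in cset l).
Proof. by rewrite inE; exact: mapP. Qed.

Lemma dec_set_nth b k v : v \in vs -> index v vs = k ->
  dec (set_nth false b k true) = v |: dec b.
Proof.
move=> vvs vk; apply/setP => w; rewrite !inE nth_set_nth /=.
have [->|wv] := eqVneq w v; first by rewrite vvs vk eqxx.
case wvs : (w \in vs) => //=; case: eqP => // wk.
by rewrite (index_vs_inj wvs vvs) ?vk ?eqxx in wv.
Qed.

Definition cone_star n l (k : nat) s :=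
  let star := seq.filter (subb s) l in
  [&& size s == n, has id s, (k < n)%N, ~~ nth false s k &
      all (fun b => set_nth false b k true \in star) star].

Fixpoint collapses n l (steps : seq (seq nat)) : option (seq bitseq) :=
  match steps with
  | [::] => Some l
  | st :: steps' =>
    let s := mkseq (fun i => i \in behead st) n in
    if cone_star n l (head 0%N st) s
    then collapses n (seq.filter (fun b => ~~ subb s b) l) steps' else None
  end.

Lemma del_star_cset l s : size s = size vs ->
  del_star (cset l) (dec s) = cset (seq.filter (fun b => ~~ subb s b) l).
Proof.
move=> ss; apply/setP => A; rewrite inE.
apply/andP/csetP => [[/csetP[b bl ->] sb]|[b]].
  by exists b => //; rewrite mem_filter bl andbT; apply: contra sb; exact: dec_sub.
rewrite mem_filter => /andP[sb bl] ->; rewrite mem_cset//; split=> //.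
by apply: contra sb; exact: sub_dec.
Qed.

Lemma collapsesP (R : realType) l steps l' : is_complex (cset l) ->
  collapses (size vs) l steps = Some l' ->
  is_complex (cset l') /\ strong_deformation_retract R
    (realization R (cset l)) (realization R (cset l')).
Proof.
elim: steps l => [|st steps IH] l cl /=.
  by move=> [<-]; split=> //; exact: strong_deformation_retract_refl.
set s := mkseq _ _; case: ifP => // /and5P[/eqP ss hs kn sk /allP cone] ll'.
have [v vvs vk] := index_onto kn.
pose l1 := seq.filter (fun b => ~~ subb s b) l.
have dl : del_star (cset l) (dec s) = cset l1 by exact: del_star_cset.
have cl1 : is_complex (cset l1) by rewrite -dl; exact: is_complex_del_star.
have [cl' l1l'] := IH l1 cl1 ll'; split => //.
apply: (@strong_deformation_retract_trans R _ _ (realization R (cset l1))) => //.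
  exact: closed_realization.
rewrite -dl; apply: (@collapse _ _ _ _ v) => //.
- have /(nthP false)[i si ti] : true \in s by move/hasP: hs => [[]].
  rewrite ss in si; have [w wvs wi] := index_onto si.
  by apply/set0Pn; exists w; rewrite inE wvs wi ti.
- by rewrite inE vvs vk.
- move=> A /csetP[b bl ->] /(sub_dec ss) sb.
  rewrite -(dec_set_nth b vvs vk); apply: mem_cset.
  have := cone b; rewrite mem_filter sb bl => /(_ isT).
  by rewrite mem_filter => /andP[].
Qed.

(** Branches on the first bit: a false bit is compatible with every generator, a true bit only with
    those that carry it. Branches without generators are cut, each face is listed once, and the
    order is lexicographic. *)
Fixpoint faces n (F : seq bitseq) : seq bitseq :=
  if F is [::] then [::] else
  match n with
  | 0 => [:: [::]]
  | m.+1 => map (cons false) (faces m (map behead F)) ++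
            map (cons true) (faces m (map behead (seq.filter (head false) F)))
  end.

Lemma mem_facesP n F b : all (fun f => size f == n) F ->
  reflect (size b = n /\ exists2 f, f \in F & subb b f) (b \in faces n F).
Proof.
elim: n F b => [|n IH] [|f0 F] b sF; try by constructor => -[_ []].
  rewrite /= inE; apply: (iffP eqP) => [->|[/size0nil->]//]; split=> //.
  by exists f0 => //; rewrite mem_head.
have sF' (G : seq bitseq) : {subset G <= f0 :: F} ->
    all (fun f => size f == n) (map behead G).
  move=> GF; rewrite all_map; apply/allP => f /GF /(allP sF) /= /eqP sf.
  by rewrite size_behead sf.
have s0 := sF' _ (fun x h => h).
have s1 : all (fun f => size f == n) (map behead (seq.filter (head false) (f0 :: F))).
  by apply: sF' => f; rewrite mem_filter => /andP[].
have -> : faces n.+1 (f0 :: F) =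
  map (cons false) (faces n (map behead (f0 :: F))) ++
  map (cons true) (faces n (map behead (seq.filter (head false) (f0 :: F)))) by [].
rewrite mem_cat {sF'}; move: {f0 F}(f0 :: F) sF s0 s1 => F sF s0 s1.
apply: (iffP orP) => [[]/mapP[c]|].
- move=> /(IH _ _ s0)[sc [_ /mapP[f fF ->] cf]] ->; split=> /=; first by rewrite sc.
  by exists f.
- move=> /(IH _ _ s1)[sc [_ /mapP[f fF ->] cf]] ->; split=> /=; first by rewrite sc.
  move: fF; rewrite mem_filter => /andP[hf fF]; exists f => //.
  by case: f hf fF cf => [|[]].
case: b => [[]//|x b] [/= [sb] [f fF bf]]; case: x bf => bf; [right|left].
  apply: map_f; apply/IH => //; split=> //.
  exists (behead f); last by case: f bf {fF} => [|[]].
  by apply: map_f; rewrite mem_filter fF andbT; case: f bf {fF} => [|[]].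
by apply: map_f; apply/IH => //; split=> //; exists (behead f) => //; exact: map_f.
Qed.

End bit_complexes.

(** * The bouquet theorem with hypotheses decidable on bit sequences *)

Section bit_wedge.
Variables (R : realType) (V : finType) (vs : seq V).
Hypothesis vs_uniq : uniq vs.
Implicit Types (l : seq bitseq) (s : bitseq).

Lemma is_complex_del_facets (K : {set {set V}}) (F : seq {set V}) :
  is_complex K ->
  (forall A, A \in F -> forall B, B \in K -> A \subset B -> B = A) ->
  is_complex (del_facets K F).
Proof.
move=> cK Fmax; apply/forall_inP => s; rewrite inE => /andP[sK sF].
rewrite card_gt0 (complex_nonempty cK sK); apply/forallP => t.
apply/implyP; rewrite card_gt0 => /andP[t0 ts]; rewrite inE.
rewrite (complex_sub cK sK t0 ts)/=; apply: contra sF => tF.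
by rewrite (Fmax _ tF _ sK ts).
Qed.

Lemma realization_point (v : V) :
  realization R [set [set v]]%SET = [set fun w => (w == v)%:R].
Proof.
apply/seteqP; split => x.
  move=> [x0 [x1]]; rewrite inE => /eqP/setP xv.
  have xw w : w != v -> x w = 0.
    by move=> wv; have := xv w; rewrite !inE (negPf wv) => /negbFE/eqP.
  apply/funext => w; have [->|/xw//] := eqVneq w v.
  by rewrite -[RHS]x1 (bigD1 v)//= big1 ?addr0// => u /xw.
move=> ->; split => [w|]; first exact: ler0n.
split; first by rewrite (bigD1 v)//= eqxx big1 ?addr0// => w /negPf->.
rewrite inE; apply/eqP/setP => w; rewrite !inE.
by rewrite pnatr_eq0 eqb0 negbK.
Qed.

Definition bit_facets l (F : seq bitseq) :=
  uniq F && all (fun s => [&& s \in l, count id s == 4%N &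
    all (fun b => subb s b ==> (b == s)) l]) F.

Theorem bit_wedge l l1 steps1 steps2 (F : seq bitseq) b :
  is_complex (cset vs l) ->
  collapses (size vs) l steps1 = Some l1 ->
  all (fun b => size b == size vs) l1 ->
  (0 < size F)%N -> bit_facets l1 F ->
  collapses (size vs) (seq.filter (fun b => b \notin F) l1) steps2 =
    Some [:: b] ->
  size b == size vs -> count id b == 1%N ->
  homotopy_equivalent R (realization R (cset vs l)) (wedge_S3 R (size F)).
Proof.
move=> cl /(collapsesP vs_uniq R cl)[cl1 ll1] /allP sl1 F0 /andP[uF /allP FP].
move=> l1b /eqP sb /eqP b1.
have Fl s : s \in F -> s \in l1 by move=> /FP/andP[].
have Fs s : s \in F -> size s = size vs by move=> /Fl/sl1/eqP.
have decF c : c \in l1 -> (dec vs c \in map (dec vs) F) = (c \in F).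
  move=> cl1'; apply/mapP/idP => [[d dF cd]|cF]; last by exists c.
  by rewrite (dec_bits_inj vs_uniq _ _ cd)// inE; apply: sl1 => //; exact: Fl.
have Fmax A : A \in map (dec vs) F -> forall t, t \in cset vs l1 ->
    A \subset t -> t = A.
  move=> /mapP[s sF ->] t /csetP[c cl1' ->] /(sub_dec vs_uniq (Fs _ sF)) sc.
  have /and3P[_ _ /allP/(_ c cl1')] := FP s sF.
  by rewrite sc => /eqP ->.
have dF : del_facets (cset vs l1) (map (dec vs) F) =
    cset vs (seq.filter (fun b => b \notin F) l1).
  apply/setP => A; rewrite inE; apply/andP/csetP => [[/csetP[c cl1' ->]]|[c]].
    by rewrite decF// => cF; exists c => //; rewrite mem_filter cF.
  by rewrite mem_filter => /andP[cF cl1'] ->; rewrite mem_cset// decF.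
have cdF : is_complex (cset vs (seq.filter (fun b => b \notin F) l1)).
  by rewrite -dF; exact: is_complex_del_facets.
have [_ dFb] := collapsesP vs_uniq R cdF l1b.
have /cards1P[v bv] : #|dec vs b| == 1%N by rewrite card_dec// b1.
have cb : cset vs [:: b] = [set [set v]]%SET.
  by apply/setP => A; rewrite !inE /= -bv.
rewrite cb realization_point -dF in dFb.
rewrite -(size_map (dec vs)).
apply: (wedge_of_facets cl1 _ _ _ ll1 dFb).
- rewrite map_inj_in_uniq// => s t sF tF; apply: dec_bits_inj => //.
    by rewrite inE Fs.
  by rewrite inE Fs.
- by rewrite size_map.
- move=> A AF; split; last exact: Fmax.
    by case/mapP: AF => s /Fl sl ->; exact: mem_cset.
  case/mapP: AF => s sF ->; rewrite card_dec ?Fs//.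
  by have /and3P[_ /eqP] := FP s sF.
Qed.

End bit_wedge.

(** * Acyclic matchings of the Hasse diagram *)

(** Membership bits of a vertex set of Delta^3, the empty set included: a concrete form that can be
    evaluated. *)
Definition quad := (bool * bool * bool * bool)%type.
Implicit Types (p q : quad * quad) (L : seq (quad * quad))
  (W : {set {set 'I_4} * {set 'I_4}}).

Definition qbits (x : quad) : bitseq :=
  let: (a, b, c, d) := x in [:: a; b; c; d].

Definition cell (x : quad) : {set 'I_4} := finset (fun i : 'I_4 => nth false (qbits x) i).

Definition cells (p : quad * quad) : {set 'I_4} * {set 'I_4} :=
  (cell p.1, cell p.2).

Lemma cell_inj : injective cell.
Proof.
move=> [[[a b] c] d] [[[a' b'] c'] d'] /setP h.
have := h (@Ordinal 4 0 isT); have := h (@Ordinal 4 1 isT).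
have := h (@Ordinal 4 2 isT); have := h (@Ordinal 4 3 isT).
by rewrite !inE /= => -> -> -> ->.
Qed.

Lemma cells_inj : injective cells.
Proof. by move=> [x y] [x' y'] [/cell_inj -> /cell_inj ->]. Qed.

Lemma cell_onto (A : {set 'I_4}) : exists x, A = cell x.
Proof.
exists (@Ordinal 4 0 isT \in A, @Ordinal 4 1 isT \in A, @Ordinal 4 2 isT \in A,
  @Ordinal 4 3 isT \in A).
by apply/setP => -[[|[|[|[|//]]]] i4]; rewrite inE /=; congr (_ \in A);
  apply/val_inj.
Qed.

Definition weight (x : quad) := count id (qbits x).

Lemma card_cell x : #|cell x| = weight x.
Proof.
case: x => [[[a b] c] d]; rewrite -sum1_card big_mkcond /= !big_ord_recl big_ord0.
by rewrite !inE /= /weight /=; case: a; case: b; case: c; case: d.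
Qed.

Definition qsub (x y : quad) := subb (qbits x) (qbits y).

Lemma sub_cell x y : (cell x \subset cell y) = qsub x y.
Proof.
apply/fintype.subsetP/subbP => h i; last by rewrite !inE; exact: h.
have [i4 xi|i4] := ltnP i 4.
  by have := h (Ordinal i4); rewrite !inE /=; apply.
by rewrite nth_default//; case: (x) i4 => [[[a b] c] d].
Qed.

Definition covers p := qsub p.1 p.2 && (weight p.2 == (weight p.1).+1).

Lemma mem_hasse (K : {set {set 'I_4}}) p : (cells p \in hasse_edges K) =
  [&& cell p.1 \in K, cell p.2 \in K & covers p].
Proof.
rewrite inE /= properEcard sub_cell !card_cell /covers -andbA.
congr [&& _, _ & _]; case: eqP => [->|]; last by rewrite !andbF.
by rewrite ltnSn andbT.
Qed.

Definition quads : seq quad :=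
  [seq (odd m, odd m./2, odd m./2./2, odd m./2./2./2) | m <- iota 0 16].

Lemma mem_quads x : x \in quads.
Proof. by case: x => [[[[] []] []] []]. Qed.

Definition bDelta3_edges := [seq p <- [seq (x, y) | x <- quads, y <- quads] |
  [&& 0 < weight p.1, weight p.2 < 4 & covers p]%N].

Definition top_edges := [seq p <- [seq (x, y) | x <- quads, y <- quads] |
  (weight p.2 == 4%N) && covers p].

(** The order matters for the certificates: positions 0 to 23 are the edges inside the boundary,
    positions 24 to 27 those ending in the tetrahedron. *)
Definition Delta3_edges := bDelta3_edges ++ top_edges.

Lemma mem_pairs p : p \in [seq (x, y) | x <- quads, y <- quads].
Proof. by case: p => x y; apply: allpairs_f; exact: mem_quads. Qed.

Lemma mem_bDelta3_edges p : (p \in bDelta3_edges) =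
  [&& 0 < weight p.1, weight p.2 < 4 & covers p]%N.
Proof. by rewrite mem_filter mem_pairs andbT. Qed.

Lemma mem_top_edges p : (p \in top_edges) = (weight p.2 == 4%N) && covers p.
Proof. by rewrite mem_filter mem_pairs andbT. Qed.

Lemma mem_Delta3_edges p :
  (p \in Delta3_edges) = [&& 0 < weight p.1, weight p.2 < 4 & covers p]%N ||
    (weight p.2 == 4%N) && covers p.
Proof. by rewrite -mem_bDelta3_edges -mem_top_edges; exact: mem_cat. Qed.

Lemma cell_bDelta3 x : (cell x \in bDelta3) = (0 < weight x < 4)%N.
Proof. by rewrite inE card_cell. Qed.

Lemma cell_Delta3 x : (cell x \in Delta3) = (0 < weight x)%N.
Proof. by rewrite inE card_cell. Qed.

Lemma hasse_bDelta3 p : (cells p \in hasse_edges bDelta3) = (p \in bDelta3_edges).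
Proof.
rewrite mem_hasse mem_bDelta3_edges !cell_bDelta3.
case cp : (covers p); rewrite ?andbF ?andbT//.
have /andP[_ /eqP ->] := cp.
by case: (weight p.1) => [|[|[|[|n]]]].
Qed.

Lemma hasse_Delta3 p : (cells p \in hasse_edges Delta3) = (p \in Delta3_edges).
Proof.
rewrite mem_hasse mem_Delta3_edges !cell_Delta3.
case cp : (covers p); rewrite ?andbF ?andbT//.
have : (weight p.2 <= 4)%N by rewrite -card_cell (leq_trans (max_card _))// card_ord.
have /andP[_ /eqP ->] := cp.
by case: (weight p.1) => [|[|[|[|n]]]].
Qed.

Lemma Delta3_edges_uniq : uniq Delta3_edges.
Proof. by vm_compute. Qed.

Lemma bDelta3_edges_uniq : uniq bDelta3_edges.
Proof. by vm_compute. Qed.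

(* Evaluates much faster than the generic equality test of a product type. *)
Definition qeq (x y : quad) : bool :=
  let: (a, b, c, d) := x in let: (a', b', c', d') := y in
  if a (+) a' then false else if b (+) b' then false else
  if c (+) c' then false else ~~ (d (+) d').

Lemma qeqE x y : qeq x y = (x == y).
Proof.
case: x => [[[a b] c] d]; case: y => [[[a' b'] c'] d'].
rewrite /qeq !xpair_eqE.
by case: a; case: a'; case: b; case: b'; case: c; case: c'; case: d; case: d'.
Qed.

Definition compatible p q := ~~ [|| qeq p.1 q.1, qeq p.1 q.2, qeq p.2 q.1 |
  qeq p.2 q.2].

Lemma compatibleE p q : compatible p q =
  [&& p.1 != q.1, p.1 != q.2, p.2 != q.1 & p.2 != q.2].
Proof. by rewrite /compatible !qeqE !negb_or. Qed.

Fixpoint matchings (es : seq (quad * quad)) : seq (seq (quad * quad)) :=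
  if es is p :: es' then
    let r := matchings es' in
    [seq p :: L | L <- r & all (compatible p) L] ++ r
  else [:: [::]].

Lemma compatible_sym p q : compatible p q = compatible q p.
Proof.
rewrite !compatibleE (eq_sym q.1 p.1) (eq_sym q.1 p.2) (eq_sym q.2 p.1).
by rewrite (eq_sym q.2 p.2) [X in _ && X]andbCA.
Qed.

Lemma mem_matchings (es : seq (quad * quad)) (a : pred (quad * quad)) : uniq es ->
  {in es &, forall p q, a p -> a q -> p != q -> compatible p q} ->
  [seq p <- es | a p] \in matchings es.
Proof.
elim: es => [//|p es IH] /= /andP[pes ues] h.
have mes : [seq p <- es | a p] \in matchings es.
  by apply: IH => // x y xes yes; apply: h; rewrite inE ?xes ?yes orbT.
rewrite mem_cat; case: ifP => [ap|_]; last by rewrite mes orbT.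
rewrite map_f// mem_filter mes andbT; apply/allP => q.
rewrite mem_filter => /andP[aq qes]; apply: h => //.
- exact: mem_head.
- by rewrite inE qes orbT.
- by apply: contraNneq pes => ->.
Qed.

Lemma matchingsP (es : seq (quad * quad)) L : uniq es -> L \in matchings es ->
  [/\ {subset L <= es}, uniq L &
      {in L &, forall p q, p != q -> compatible p q}].
Proof.
elim: es L => [|p es IH] L /=; first by rewrite inE => _ /eqP ->.
move=> /andP[pes ues]; rewrite mem_cat => /orP[/mapP[M]|]; last first.
  by move=> /(IH _ ues)[Les uL cL]; split=> // q /Les; rewrite inE orbC => ->.
rewrite mem_filter => /andP[/allP pM /(IH _ ues)[Mes uM cM]] ->; split.
- by move=> q; rewrite !inE => /orP[->//|/Mes ->]; rewrite orbT.
- by rewrite /= uM andbT; apply: contra pes; exact: Mes.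
- move=> q r; rewrite !inE => /orP[/eqP ->|qM] /orP[/eqP ->|rM].
  + by rewrite eqxx.
  + by move=> _; exact: pM.
  + by move=> _; rewrite compatible_sym; exact: pM.
  + exact: cM.
Qed.

(** * Enumerating the acyclic matchings of maximum size *)

Section optimal_matchings.
Variables (K : {set {set 'I_4}}) (es : seq (quad * quad)).
Hypotheses (es_uniq : uniq es)
  (hasseE : forall p, (cells p \in hasse_edges K) = (p \in es)).

Definition edge_set L : {set {set 'I_4} * {set 'I_4}} :=
  finset (fun e => e \in map cells L).

Lemma mem_edge_set L p : (cells p \in edge_set L) = (p \in L).
Proof. by rewrite inE mem_map//; exact: cells_inj. Qed.

Lemma edge_setP L e : reflect (exists2 p, p \in L & e = cells p) (e \in edge_set L).
Proof. by rewrite inE; exact: mapP. Qed.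

Lemma card_edge_set L : uniq L -> #|edge_set L| = size L.
Proof.
move=> uL; rewrite cardsE -(size_map cells); apply/card_uniqP.
by rewrite map_inj_uniq//; exact: cells_inj.
Qed.

Lemma cells_onto e : exists p, e = cells p.
Proof.
case: e => A B; have [x ->] := cell_onto A; have [y ->] := cell_onto B.
by exists (x, y).
Qed.

Lemma edge_set_filter W : W \subset hasse_edges K ->
  edge_set [seq p <- es | cells p \in W] = W.
Proof.
move=> /fintype.subsetP Wh; apply/setP => e; have [p ->] := cells_onto e.
rewrite mem_edge_set mem_filter; case pW : (cells p \in W) => //=.
by rewrite -hasseE Wh.
Qed.

Lemma is_matching_edge_set L : {subset L <= es} ->
  {in L &, forall p q, p != q -> compatible p q} ->
  is_matching K (edge_set L).
Proof.
move=> Les cL; apply/andP; split.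
  by apply/fintype.subsetP => e /edge_setP[p /Les pes ->]; rewrite hasseE.
apply/forall_inP => e /edge_setP[p pL ->].
apply/forall_inP => f /edge_setP[q qL ->]; apply/implyP.
rewrite (inj_eq cells_inj) => /(cL _ _ pL qL).
by rewrite compatibleE /= !(inj_eq cell_inj).
Qed.

Lemma matching_in_matchings W : is_matching K W ->
  [seq p <- es | cells p \in W] \in matchings es.
Proof.
move=> /andP[_ /forall_inP mW]; apply: mem_matchings => // p q _ _ pW qW pq.
have /forall_inP/(_ _ qW) := mW _ pW.
by rewrite (inj_eq cells_inj) pq compatibleE /= !(inj_eq cell_inj).
Qed.

Definition arcs L := [seq if p \in L then (p.2, p.1) else p | p <- es].

Lemma mem_arcs L x y : {subset L <= es} ->
  modified_hasse K (edge_set L) (cell x) (cell y) = ((x, y) \in arcs L).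
Proof.
move=> Les; rewrite /modified_hasse.
rewrite -[(cell x, cell y)]/(cells (x, y)) -[(cell y, cell x)]/(cells (y, x)).
rewrite hasseE !mem_edge_set; apply/idP/mapP.
  case/orP => [/andP[xy nxy]|yx]; first by exists (x, y); rewrite ?(negPf nxy).
  by exists (y, x); rewrite ?yx//; exact: Les.
move=> [[u v] uv]; case: ifP => uvL [-> ->]; first by rewrite uvL orbT.
by rewrite uv uvL.
Qed.

Definition exits (A : seq (quad * quad)) (S : seq quad) (x : quad) :=
  has (fun a => if qeq a.1 x then has (qeq a.2) S else false) A.

Lemma exitsP (A : seq (quad * quad)) (S : seq quad) x :
  reflect (exists2 y, (x, y) \in A & y \in S) (exits A S x).
Proof.
apply: (iffP hasP) => [[[u y] uyA] /=|[y xyA yS]].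
  rewrite qeqE; case: eqP => // <- /hasP[z zS]; rewrite qeqE => /eqP yz.
  by exists y; rewrite // yz.
exists (x, y) => //=; rewrite qeqE eqxx.
by apply/hasP; exists y; rewrite // qeqE.
Qed.

Definition peel (A : seq (quad * quad)) (S : seq quad) :=
  [seq x <- S | exits A S x].

(* Thirteen rounds reach the fixpoint for every matching inspected below; a
   nonempty result only counts after [trapped] has confirmed this. *)
Definition core L := let A := arcs L in iter 13 (peel A) quads.

Definition trapped L (S : seq quad) := let A := arcs L in all (exits A S) S.

(* A vertex with the fewest reachable vertices is reachable from any of its
   successors, hence lies on a cycle. *)
Lemma trapped_cyclic L S : {subset L <= es} -> S != [::] -> trapped L S ->
  ~~ is_acyclic K (edge_set L).
Proof.
move=> Les S0 /allP tS; apply/negP => /forallP acyc.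
have [x0 x0S] : exists x0, x0 \in S.
  by case: S S0 {tS} => // x S _; exists x; rewrite mem_head.
pose reach x := #|connect (modified_hasse K (edge_set L)) (cell x)|.
have [x xS xmin] := arg_minnP reach x0S.
have /exitsP[y] := tS _ xS; rewrite -mem_arcs// => xy yS.
have /forallP/(_ (cell y)) := acyc (cell x); rewrite xy /= => nyx.
have := xmin y yS; rewrite leqNgt => /negP; apply.
apply: proper_card; apply/properP; split.
  apply/fintype.subsetP => z yz; apply: connect_trans yz; exact: connect1.
by exists (cell x); [exact: connect0|exact: nyx].
Qed.

(** Peeling removes vertices without a surviving successor. Every vertex in the strongly connected
    class [C] of an arc on a cycle has a successor in [C], so a cycle would survive all rounds. *)
Lemma core_acyclic L : {subset L <= es} -> core L = [::] ->
  is_acyclic K (edge_set L).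
Proof.
move=> Les coreL; set r := modified_hasse K (edge_set L).
apply/forallP => A; apply/forallP => B; apply/implyP => AB; apply/negP => BA.
have [x Ax] := cell_onto A.
pose C z := connect r z A && connect r A z.
suff Cn n z : C (cell z) -> z \in iter n (peel (arcs L)) quads.
  have : x \in core L by apply: (Cn 13%N); rewrite /C -Ax connect0.
  by rewrite coreL.
elim: n z => [|n IH] z Cz; first by rewrite mem_quads.
rewrite iterS mem_filter IH// andbT.
(* The successor is the next vertex on a path to [A]; if that path is trivial, the vertex is [A]
   itself and [B] serves. *)
have [w zw Cw] : exists2 w, r (cell z) w & C w.
  case/andP: Cz => /connectP[[|w s]] /=.
    move=> _ /= Az _; exists B; first by rewrite -Az.
    by rewrite /C BA connect1.
  move=> /andP[zw ws] sA Az; exists w => //; apply/andP; split.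
    by apply/connectP; exists s.
  exact: connect_trans Az (connect1 zw).
have [y wy] := cell_onto w; subst w.
by apply/exitsP; exists y; rewrite -?mem_arcs// IH.
Qed.

(* Boolean connectives are strict under [vm_compute]; filtering by size first
   (and [if] in [exits]) keeps the expensive tests from being evaluated. *)
Definition large_matchings n := [seq L <- matchings es | n <= size L]%N.

Definition optimal_matchings n :=
  [seq L <- large_matchings n | core L == [::]].

Definition optimal_size n :=
  let Ls := large_matchings n in
  all (fun L => let S := core L in
         if S is [::] then size L == n else trapped L S) Ls
  && ([seq L <- Ls | core L == [::]] != [::]).

Variable n : nat.
Hypothesis nP : optimal_size n.

Lemma optimal_matchingsP L : L \in optimal_matchings n ->
  [/\ {subset L <= es}, acyclic_matching K (edge_set L) & #|edge_set L| = n].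
Proof.
rewrite mem_filter => /andP[coreL nmL].
have := nmL; rewrite mem_filter => /andP[nL mL].
have [Les uL cL] := matchingsP es_uniq mL; split => //.
  rewrite /acyclic_matching is_matching_edge_set// core_acyclic//.
  exact/eqP.
rewrite card_edge_set//; have /andP[/allP/(_ L nmL)] := nP.
by rewrite (eqP coreL) => /eqP.
Qed.

Lemma acyclic_optimal W : acyclic_matching K W -> (n <= #|W|)%N ->
  exists2 L, L \in optimal_matchings n & W = edge_set L.
Proof.
move=> /andP[mW aW] nW; have /andP[Wh _] := mW.
have mL := matching_in_matchings mW; set L := [seq _ <- es | _] in mL.
have WL : W = edge_set L by rewrite edge_set_filter.
have [Les uL _] := matchingsP es_uniq mL.
exists L => //; rewrite WL card_edge_set// in nW.
have nmL : L \in large_matchings n by rewrite mem_filter nW.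
rewrite mem_filter nmL andbT; have /andP[/allP/(_ L nmL)] := nP.
case coreL : (core L) => [//|x S] trap.
have := @trapped_cyclic L (core L) Les; rewrite coreL => /(_ isT trap).
by rewrite -WL aW.
Qed.

Lemma max_acyclic_sizeE : max_acyclic_size K = n.
Proof.
apply/eqP; rewrite eqn_leq; apply/andP; split.
  apply/bigmax_leqP => W aW; rewrite leqNgt; apply/negP => nW.
  have [L Lo WL] := acyclic_optimal aW (ltnW nW).
  by have [_ _ Ln] := optimal_matchingsP Lo; rewrite WL Ln ltnn in nW.
have /andP[_] := nP; rewrite -/(optimal_matchings n).
case E : (optimal_matchings n) => [//|L s] _.
have /optimal_matchingsP[_ aL <-] : L \in optimal_matchings n.
  by rewrite E mem_head.
exact: leq_bigmax_cond.
Qed.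

Variable es3 : seq (quad * quad).
Hypotheses (es3_uniq : uniq es3) (es_sub : {subset es <= es3}).

(** Bits are indexed by [es3], not by [es], so that the complexes of Delta^3 and of its boundary are
    encoded over the same vertices and can be compared. *)
Definition edge_bits L : bitseq := [seq p \in L | p <- es3].

Definition pure_bits : seq bitseq :=
  [seq b <- faces (size es3) (map edge_bits (optimal_matchings n)) | has id b].

Let vs := map cells es3.

Lemma dec_edge_bits L : {subset L <= es3} -> dec vs (edge_bits L) = edge_set L.
Proof.
move=> Les; apply/setP => e; have [p ->] := cells_onto e.
rewrite mem_edge_set inE /vs (mem_map cells_inj).
rewrite index_map; last exact: cells_inj.
case pes : (p \in es3); last first.
  by apply/esym/negP => /Les; rewrite pes.
by rewrite (nth_map p) ?index_mem// nth_index.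
Qed.

Lemma pure_morse_complexE : pure_morse_complex K = cset vs pure_bits.
Proof.
have vs_uniq : uniq vs by rewrite map_inj_uniq//; exact: cells_inj.
have svs : size vs = size es3 by rewrite size_map.
have sF : all (fun f => size f == size es3) (map edge_bits (optimal_matchings n)).
  by rewrite all_map; apply/allP => L _ /=; rewrite size_map.
apply/setP => W; rewrite inE max_acyclic_sizeE; apply/andP/csetP.
  move=> [W0 /existsP[M /and3P[aM /eqP Mn WM]]].
  have [|L Lo ML] := acyclic_optimal aM; first by rewrite Mn.
  have [Les _ _] := optimal_matchingsP Lo.
  have Les3 : {subset L <= es3} by move=> p /Les; exact: es_sub.
  have Wd : W = dec vs [seq v \in W | v <- vs].
    apply/setP => e; rewrite inE; case evs : (e \in vs).
      by rewrite (nth_map e) ?index_mem// nth_index.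
    apply/negP => /(fintype.subsetP WM); rewrite ML => /edge_setP[p /Les3 pes ee].
    by move: evs; rewrite ee /vs map_f.
  exists [seq v \in W | v <- vs] => //.
  rewrite mem_filter; apply/andP; split.
    have [e eW] : exists e, e \in W by exact/card_gt0P.
    move: (eW); rewrite {1}Wd inE => /andP[evs _]; rewrite has_map.
    by apply/hasP; exists e.
  apply/mem_facesP => //; split; first by rewrite !size_map.
  exists (edge_bits L); first exact: map_f.
  by apply: (sub_dec vs_uniq); rewrite ?size_map// -Wd dec_edge_bits// -ML.
move=> [b]; rewrite mem_filter => /andP[hb].
move=> /(mem_facesP _ sF)[sb [_ /mapP[L Lo ->] bL]] ->; split.
  rewrite card_dec// ?sb ?svs//.
  by rewrite -has_count.
have [Les aL Ln] := optimal_matchingsP Lo.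
apply/existsP; exists (edge_set L); rewrite aL Ln eqxx /=.
rewrite -dec_edge_bits; first exact: dec_sub.
by move=> p /Les; exact: es_sub.
Qed.

End optimal_matchings.

Lemma is_complex_pure (K : {set {set 'I_4}}) : is_complex (pure_morse_complex K).
Proof.
apply/forall_inP => W; rewrite inE => /andP[-> /existsP[M /and3P[aM Mn WM]]] /=.
apply/forallP => U; apply/implyP => /andP[U0 UW]; rewrite inE U0.
by apply/existsP; exists M; rewrite aM Mn (fintype.subset_trans UW).
Qed.

(** * Certificates *)

(* Each row [:: v; i1; ...; im] of a collapse removes the star of the simplex
   {i1, ..., im}, which is a cone with apex v; the numbers are positions in
   [Delta3_edges].  The rows were found by a computer search. *)
Definition Delta3_steps : seq (seq nat) := [::
  [:: 19; 3; 16; 25]; [:: 22; 2; 8; 25]; [:: 3; 2; 13; 25]; [:: 0; 5; 18; 24];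
  [:: 7; 5; 15; 26]; [:: 19; 1; 17; 27]; [:: 19; 1; 10; 27]; [:: 1; 10; 19;
  24]; [:: 7; 15; 21; 26]; [:: 13; 5; 17; 27]; [:: 22; 8; 15; 25]; [:: 12; 0;
  4; 24]; [:: 13; 3; 8; 25]; [:: 14; 5; 22; 24]; [:: 13; 7; 8; 27]; [:: 13; 1;
  3; 25]; [:: 16; 4; 23; 25]; [:: 11; 0; 4; 25]; [:: 12; 15; 23; 24]; [:: 6;
  1; 4; 26]; [:: 22; 11; 16; 27]; [:: 6; 1; 4; 27]; [:: 14; 3; 8; 24]; [:: 23;
  5; 13; 26]; [:: 13; 1; 3; 27]; [:: 20; 2; 3; 24]; [:: 16; 18; 23; 24]; [::
  7; 1; 5; 24]; [:: 6; 2; 14; 25]; [:: 11; 2; 17; 26]; [:: 20; 4; 19; 27]; [::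
  21; 11; 15; 25]; [:: 18; 6; 21; 26]; [:: 21; 0; 12; 25]; [:: 22; 4; 16; 27];
  [:: 21; 3; 12; 25]; [:: 19; 11; 14; 25]; [:: 12; 2; 9; 24]; [:: 13; 10; 18;
  27]; [:: 6; 4; 15; 25]; [:: 7; 2; 4; 24]; [:: 11; 7; 10; 26]; [:: 20; 6; 10;
  27]; [:: 11; 2; 10; 26]; [:: 7; 16; 19; 24]; [:: 12; 10; 18; 24]; [:: 11; 3;
  9; 26]; [:: 22; 9; 15; 27]; [:: 7; 5; 15; 24]; [:: 12; 9; 18; 24]; [:: 15;
  10; 20; 26]; [:: 11; 7; 9; 26]; [:: 6; 5; 12; 25]; [:: 20; 4; 12; 27]; [::
  21; 0; 15; 25]; [:: 20; 8; 17; 27]; [:: 20; 3; 17; 27]; [:: 13; 7; 12; 27];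
  [:: 18; 1; 16; 26]; [:: 23; 9; 16; 25]; [:: 13; 3; 8; 26]; [:: 2; 7; 9; 27];
  [:: 11; 17; 20; 26]; [:: 18; 13; 21; 26]; [:: 17; 19; 21; 24]; [:: 21; 0;
  22; 25]; [:: 23; 4; 20; 26]; [:: 6; 14; 22; 25]; [:: 19; 5; 11; 25]; [:: 6;
  4; 12; 25]; [:: 14; 3; 22; 24]; [:: 6; 12; 23; 25]; [:: 7; 1; 9; 24]; [::
  19; 13; 23; 25]; [:: 6; 9; 12; 27]; [:: 22; 6; 18; 27]; [:: 6; 14; 15; 25];
  [:: 8; 0; 13; 26]; [:: 22; 6; 16; 27]; [:: 20; 11; 19; 27]; [:: 13; 5; 19;
  27]; [:: 11; 7; 21; 26]; [:: 23; 9; 20; 26]; [:: 11; 0; 4; 26]; [:: 11; 2;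
  14; 26]; [:: 7; 4; 22; 24]; [:: 23; 6; 20; 26]; [:: 20; 0; 19; 27]; [:: 13;
  7; 19; 27]; [:: 18; 1; 10; 26]; [:: 6; 2; 5; 25]; [:: 18; 0; 16; 26]; [::
  20; 6; 19; 27]; [:: 3; 10; 13; 26]; [:: 6; 2; 16; 25]; [:: 12; 2; 17; 24];
  [:: 19; 0; 14; 25]; [:: 21; 4; 10; 24]; [:: 19; 13; 16; 25]; [:: 23; 6; 15;
  26]; [:: 14; 1; 3; 24]; [:: 6; 4; 8; 25]; [:: 21; 2; 10; 25]; [:: 17; 3; 21;
  24]; [:: 15; 1; 20; 26]; [:: 11; 2; 21; 26]; [:: 19; 0; 16; 25]; [:: 17; 8;
  21; 26]; [:: 17; 18; 21; 24]; [:: 23; 13; 15; 26]; [:: 6; 12; 14; 25]; [::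
  13; 12; 16; 27]; [:: 13; 5; 10; 27]; [:: 14; 10; 16; 26]; [:: 18; 8; 14;
  26]; [:: 13; 3; 12; 27]; [:: 14; 10; 16; 24]; [:: 21; 1; 13; 25]; [:: 7; 9;
  19; 24]; [:: 12; 9; 16; 24]; [:: 23; 4; 16; 26]; [:: 18; 6; 16; 26]; [:: 23;
  1; 7; 26]; [:: 11; 10; 15; 26]; [:: 11; 7; 14; 26]; [:: 20; 0; 15; 24]; [::
  20; 3; 15; 24]; [:: 14; 10; 20; 24]; [:: 22; 3; 11; 27]; [:: 14; 8; 18; 24];
  [:: 21; 13; 17; 25]; [:: 23; 5; 9; 26]; [:: 18; 0; 21; 26]; [:: 12; 3; 23;
  24]; [:: 23; 8; 20; 26]; [:: 12; 0; 23; 24]; [:: 19; 5; 13; 25]; [:: 6; 1;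
  14; 25]; [:: 14; 5; 8; 24]; [:: 12; 9; 20; 24]; [:: 14; 19; 20; 24]; [:: 4;
  1; 23; 24]; [:: 7; 5; 19; 24]; [:: 18; 6; 10; 26]; [:: 12; 3; 9; 24]; [::
  17; 1; 14; 26]; [:: 7; 1; 4; 24]; [:: 6; 1; 4; 25]; [:: 7; 4; 8; 24]; [::
  12; 20; 23; 24]; [:: 8; 7; 13; 26]; [:: 21; 2; 4; 25]; [:: 18; 0; 17; 26];
  [:: 6; 5; 22; 25]; [:: 20; 4; 10; 27]; [:: 19; 1; 16; 25]; [:: 13; 3; 10;
  27]; [:: 14; 5; 17; 24]; [:: 23; 0; 8; 26]; [:: 21; 12; 13; 25]; [:: 22; 6;
  8; 27]; [:: 7; 21; 22; 24]; [:: 12; 0; 9; 24]; [:: 14; 17; 20; 24]; [:: 15;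
  9; 22; 24]; [:: 22; 5; 9; 27]; [:: 7; 2; 23; 24]; [:: 15; 1; 20; 24]; [::
  14; 20; 22; 24]; [:: 22; 5; 8; 27]; [:: 13; 7; 17; 27]; [:: 12; 0; 21; 24];
  [:: 2; 13; 20; 26]; [:: 19; 1; 10; 25]; [:: 14; 3; 16; 24]; [:: 11; 4; 7;
  26]; [:: 21; 2; 17; 25]; [:: 7; 1; 21; 24]; [:: 21; 13; 22; 25]; [:: 6; 8;
  14; 25]; [:: 13; 10; 16; 27]; [:: 21; 10; 13; 25]; [:: 23; 7; 8; 26]; [:: 5;
  0; 10; 24]; [:: 13; 1; 7; 27]; [:: 23; 5; 9; 25]; [:: 18; 6; 9; 26]; [:: 23;
  2; 9; 26]; [:: 20; 0; 15; 27]; [:: 19; 11; 23; 25]; [:: 11; 3; 17; 25]; [::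
  20; 10; 11; 27]; [:: 13; 16; 19; 27]; [:: 3; 8; 19; 27]; [:: 14; 0; 8; 24];
  [:: 14; 1; 18; 24]; [:: 6; 1; 17; 25]; [:: 19; 4; 17; 25]; [:: 19; 11; 17;
  25]; [:: 6; 14; 17; 25]; [:: 3; 13; 15; 25]; [:: 13; 5; 12; 27]; [:: 19; 0;
  17; 25]; [:: 12; 2; 5; 24]; [:: 22; 5; 11; 27]; [:: 19; 8; 17; 25]; [:: 23;
  2; 13; 26]; [:: 14; 3; 19; 24]; [:: 22; 4; 18; 27]; [:: 23; 2; 16; 26]; [::
  14; 1; 15; 24]; [:: 11; 0; 15; 26]; [:: 12; 4; 16; 24]; [:: 6; 1; 15; 25];
  [:: 21; 3; 15; 25]; [:: 7; 4; 19; 24]; [:: 22; 5; 6; 27]; [:: 21; 9; 17;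
  25]; [:: 7; 8; 17; 24]; [:: 20; 9; 17; 27]; [:: 16; 8; 18; 27]; [:: 7; 19;
  23; 24]; [:: 14; 2; 22; 24]; [:: 16; 8; 23; 24]; [:: 19; 11; 16; 25]; [::
  13; 0; 8; 27]; [:: 18; 0; 10; 26]; [:: 21; 4; 22; 25]; [:: 4; 11; 17; 27];
  [:: 20; 6; 17; 27]; [:: 7; 2; 16; 24]; [:: 21; 9; 22; 25]; [:: 11; 14; 20;
  26]; [:: 6; 9; 12; 25]; [:: 11; 5; 10; 26]; [:: 22; 3; 18; 27]; [:: 12; 2;
  10; 24]; [:: 6; 5; 15; 25]; [:: 13; 8; 16; 27]; [:: 6; 1; 22; 25]; [:: 11;
  7; 17; 26]; [:: 22; 7; 11; 27]; [:: 7; 8; 21; 24]; [:: 23; 2; 3; 26]; [:: 7;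
  15; 21; 24]; [:: 11; 7; 16; 26]; [:: 22; 9; 16; 27]; [:: 14; 18; 22; 24];
  [:: 18; 4; 10; 26]; [:: 14; 0; 19; 24]; [:: 18; 3; 16; 26]; [:: 3; 2; 11;
  25]; [:: 13; 10; 15; 27]; [:: 19; 5; 10; 25]; [:: 22; 2; 11; 27]; [:: 19; 4;
  10; 25]; [:: 14; 8; 20; 24]; [:: 19; 0; 23; 25]; [:: 20; 6; 15; 27]; [:: 19;
  8; 23; 25]; [:: 23; 1; 15; 26]; [:: 20; 2; 3; 27]; [:: 22; 9; 18; 27]; [::
  8; 0; 5; 25]; [:: 6; 1; 5; 25]; [:: 23; 2; 8; 26]; [:: 11; 0; 5; 26]; [::
  12; 3; 10; 24]; [:: 11; 0; 14; 26]; [:: 2; 6; 12; 27]; [:: 18; 6; 17; 26];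
  [:: 17; 1; 21; 26]; [:: 6; 2; 23; 25]; [:: 13; 17; 18; 27]; [:: 11; 14; 15;
  26]; [:: 20; 2; 6; 27]; [:: 18; 5; 6; 26]; [:: 13; 0; 12; 27]; [:: 12; 9;
  17; 24]; [:: 6; 1; 23; 25]; [:: 8; 13; 16; 26]; [:: 21; 3; 22; 25]; [:: 14;
  16; 22; 24]; [:: 6; 12; 16; 25]; [:: 22; 3; 16; 27]; [:: 21; 11; 22; 25];
  [:: 13; 3; 8; 27]; [:: 22; 11; 15; 27]; [:: 18; 13; 17; 26]; [:: 23; 0; 9;
  26]; [:: 18; 6; 14; 26]; [:: 19; 3; 14; 25]; [:: 23; 9; 16; 26]; [:: 20; 3;
  19; 27]; [:: 20; 4; 8; 27]; [:: 19; 10; 16; 25]; [:: 18; 3; 21; 26]; [:: 11;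
  0; 9; 25]; [:: 12; 4; 18; 24]; [:: 6; 12; 17; 25]; [:: 23; 9; 15; 26]; [::
  19; 10; 11; 25]; [:: 20; 8; 15; 27]; [:: 13; 2; 10; 27]; [:: 22; 1; 15; 27];
  [:: 13; 7; 10; 27]; [:: 12; 5; 10; 24]; [:: 11; 0; 20; 26]; [:: 23; 8; 16;
  26]; [:: 20; 9; 19; 27]; [:: 19; 0; 8; 25]; [:: 6; 15; 23; 25]; [:: 18; 1;
  17; 26]; [:: 20; 3; 15; 27]; [:: 18; 8; 17; 26]; [:: 23; 8; 15; 26]; [:: 22;
  4; 7; 27]; [:: 13; 12; 18; 27]; [:: 14; 0; 22; 24]; [:: 22; 1; 18; 27]; [::
  12; 17; 18; 24]; [:: 12; 4; 20; 24]; [:: 6; 16; 22; 25]; [:: 22; 0; 9; 27];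
  [:: 9; 3; 23; 25]; [:: 6; 1; 9; 25]; [:: 4; 2; 6; 26]; [:: 11; 3; 14; 26];
  [:: 14; 10; 15; 24]; [:: 20; 4; 17; 27]; [:: 20; 4; 15; 27]; [:: 9; 2; 3;
  25]; [:: 12; 2; 21; 24]; [:: 22; 11; 18; 27]; [:: 22; 2; 8; 27]; [:: 11; 17;
  26]; [:: 23; 13; 26]; [:: 20; 10; 27]; [:: 7; 19; 24]; [:: 14; 0; 24]; [::
  12; 5; 24]; [:: 20; 12; 27]; [:: 20; 3; 27]; [:: 18; 6; 26]; [:: 20; 19;
  27]; [:: 19; 23; 25]; [:: 13; 7; 27]; [:: 7; 1; 24]; [:: 14; 3; 24]; [:: 13;
  16; 27]; [:: 21; 13; 25]; [:: 13; 5; 27]; [:: 11; 16; 26]; [:: 6; 12; 25];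
  [:: 8; 22; 24]; [:: 19; 17; 25]; [:: 7; 8; 24]; [:: 18; 10; 26]; [:: 22; 11;
  27]; [:: 21; 11; 25]; [:: 18; 9; 26]; [:: 0; 18; 27]; [:: 21; 3; 25]; [::
  19; 5; 25]; [:: 6; 22; 25]; [:: 11; 14; 26]; [:: 11; 20; 26]; [:: 18; 1;
  26]; [:: 11; 7; 26]; [:: 11; 15; 26]; [:: 12; 10; 24]; [:: 22; 15; 27]; [::
  7; 4; 24]; [:: 12; 23; 24]; [:: 22; 4; 27]; [:: 18; 8; 26]; [:: 23; 2; 26];
  [:: 14; 20; 24]; [:: 13; 17; 27]; [:: 6; 16; 25]; [:: 21; 15; 25]; [:: 20;
  9; 27]; [:: 7; 2; 24]; [:: 21; 1; 25]; [:: 21; 2; 25]; [:: 20; 6; 27]; [::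
  16; 18; 24]; [:: 12; 21; 24]; [:: 21; 0; 25]; [:: 12; 9; 24]; [:: 13; 8;
  27]; [:: 18; 21; 26]; [:: 11; 0; 26]; [:: 21; 4; 25]; [:: 6; 14; 25]; [::
  13; 27]; [:: 14; 24]; [:: 23; 26]; [:: 19; 25]
]%N.

(** Every removed simplex has three or four vertices, so all vertices and all 1-simplices of the
    pure complex survive. *)
Definition bDelta3_steps : seq (seq nat) := [::
  [:: 17; 9; 19; 21]; [:: 17; 8; 19; 20]; [:: 14; 5; 11; 17]; [:: 0; 4; 12;
  18]; [:: 2; 7; 12; 16]; [:: 19; 7; 8; 17]; [:: 22; 1; 14; 15]; [:: 7; 1; 5;
  13]; [:: 1; 7; 9; 19]; [:: 1; 6; 9; 19]; [:: 20; 0; 15; 23]; [:: 7; 2; 11;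
  16]; [:: 15; 1; 21; 22]; [:: 16; 4; 18; 22]; [:: 15; 0; 20; 22]; [:: 21; 4;
  10; 18]; [:: 14; 10; 11; 16]; [:: 23; 4; 16; 19]; [:: 6; 4; 8; 20]; [:: 23;
  9; 16; 19]; [:: 3; 1; 14; 20]; [:: 4; 7; 8; 21]; [:: 20; 3; 15; 23]; [:: 0;
  5; 12; 18]; [:: 1; 6; 10; 18]; [:: 10; 11; 14; 15]; [:: 16; 3; 18; 23]; [::
  8; 0; 13; 23]; [:: 22; 2; 8; 21]; [:: 9; 3; 11; 22]; [:: 12; 10; 13; 15];
  [:: 0; 5; 11; 19]; [:: 5; 6; 14; 15]; [:: 9; 3; 12; 23]; [:: 21; 4; 7; 10];
  [:: 22; 2; 8; 14]; [:: 14; 5; 6; 17]; [:: 12; 2; 6; 9]; [:: 6; 1; 4; 20];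
  [:: 21; 7; 9; 17]; [:: 6; 1; 9; 18]; [:: 16; 3; 18; 22]; [:: 21; 9; 17; 18];
  [:: 23; 5; 9; 19]; [:: 7; 2; 5; 11]; [:: 7; 5; 13; 15]; [:: 9; 5; 11; 22];
  [:: 23; 4; 12; 16]; [:: 17; 8; 19; 21]; [:: 0; 4; 11; 19]; [:: 7; 2; 5; 13];
  [:: 3; 2; 14; 20]; [:: 6; 1; 4; 18]; [:: 17; 9; 19; 20]; [:: 13; 3; 8; 23];
  [:: 20; 3; 14; 15]; [:: 3; 2; 13; 21]; [:: 0; 4; 11; 18]; [:: 16; 4; 18;
  23]; [:: 10; 12; 13; 16]; [:: 13; 1; 3; 21]; [:: 18; 3; 12; 16]; [:: 18; 0;
  5; 22]; [:: 13; 0; 8; 21]; [:: 6; 4; 8; 18]; [:: 14; 6; 10; 16]; [:: 23; 5;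
  9; 12]; [:: 11; 0; 9; 19]; [:: 4; 6; 10; 21]; [:: 0; 5; 11; 18]; [:: 13; 3;
  8; 21]; [:: 12; 2; 6; 17]; [:: 12; 2; 13; 17]; [:: 2; 7; 11; 17]; [:: 6; 1;
  9; 20]; [:: 12; 6; 10; 15]; [:: 10; 12; 14; 15]; [:: 8; 2; 13; 22]; [:: 18;
  0; 12; 16]; [:: 20; 2; 3; 23]; [:: 19; 1; 17; 20]; [:: 17; 8; 18; 21]; [::
  11; 3; 9; 19]; [:: 19; 1; 7; 10]; [:: 12; 2; 6; 10]; [:: 5; 7; 14; 15]; [::
  9; 5; 11; 23]; [:: 21; 4; 17; 18]; [:: 22; 8; 15; 21]; [:: 15; 0; 21; 22];
  [:: 11; 0; 9; 22]; [:: 7; 5; 11; 15]; [:: 8; 0; 14; 22]; [:: 19; 1; 10; 20];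
  [:: 13; 1; 3; 23]; [:: 11; 0; 4; 22]; [:: 21; 4; 7; 17]; [:: 4; 6; 8; 21];
  [:: 16; 3; 19; 23]; [:: 8; 14; 15; 22]; [:: 19; 1; 4; 10]; [:: 13; 1; 3;
  20]; [:: 5; 6; 10; 14]; [:: 13; 0; 8; 22]; [:: 10; 2; 12; 13]; [:: 8; 2; 13;
  23]; [:: 14; 10; 12; 16]; [:: 14; 1; 5; 17]; [:: 20; 2; 3; 13]; [:: 13; 1;
  3; 15]; [:: 10; 5; 11; 14]; [:: 15; 1; 20; 22]; [:: 8; 5; 13; 23]; [:: 14;
  2; 5; 17]; [:: 20; 2; 3; 8]; [:: 17; 6; 19; 21]; [:: 8; 14; 20; 22]; [:: 0;
  11; 18; 23]; [:: 16; 11; 18; 22]; [:: 9; 12; 18; 23]; [:: 22; 3; 8; 15]; [::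
  11; 3; 9; 23]; [:: 4; 6; 10; 20]; [:: 16; 0; 18; 22]; [:: 8; 5; 13; 22]; [::
  15; 1; 20; 23]; [:: 12; 2; 7; 17]; [:: 14; 2; 5; 10]; [:: 7; 2; 5; 9]; [::
  19; 1; 7; 17]; [:: 7; 2; 13; 16]; [:: 4; 2; 6; 21]; [:: 5; 1; 6; 10]; [::
  20; 0; 14; 15]; [:: 16; 1; 3; 22]; [:: 16; 13; 19; 23]; [:: 15; 6; 21; 22];
  [:: 14; 2; 10; 16]; [:: 5; 7; 14; 17]; [:: 13; 1; 10; 21]; [:: 3; 2; 14;
  17]; [:: 14; 1; 5; 10]; [:: 16; 13; 18; 22]; [:: 20; 0; 8; 15]; [:: 6; 9;
  18; 22]; [:: 5; 7; 13; 17]; [:: 0; 5; 13; 18]; [:: 16; 13; 18; 23]; [:: 0;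
  5; 10; 18]; [:: 10; 2; 11; 14]; [:: 14; 5; 17; 18]; [:: 17; 1; 18; 21]; [::
  6; 1; 5; 18]; [:: 19; 7; 10; 16]; [:: 19; 5; 8; 13]; [:: 6; 1; 18; 23]; [::
  23; 5; 9; 18]; [:: 8; 0; 5; 18]; [:: 8; 5; 14; 18]; [:: 3; 1; 13; 18]; [::
  16; 1; 18; 22]; [:: 16; 9; 18; 23]; [:: 10; 5; 7; 13]; [:: 12; 2; 10; 14];
  [:: 19; 5; 8; 17]; [:: 8; 16; 18; 22]; [:: 19; 1; 10; 13]; [:: 14; 1; 6;
  18]; [:: 14; 1; 16; 18]; [:: 11; 0; 9; 16]; [:: 19; 1; 3; 13]; [:: 0; 5; 14;
  17]; [:: 8; 0; 18; 23]; [:: 8; 16; 18; 23]; [:: 0; 5; 12; 13]; [:: 19; 1;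
  13; 17]; [:: 8; 14; 18; 22]; [:: 5; 7; 12; 14]; [:: 19; 1; 10; 16]; [:: 14;
  1; 10; 19]; [:: 21; 0; 9; 18]; [:: 22; 2; 7; 14]; [:: 6; 2; 14; 16]; [:: 6;
  2; 5; 14]; [:: 3; 9; 11; 18]; [:: 14; 11; 16; 18]; [:: 23; 2; 5; 12]; [::
  23; 2; 12; 16]; [:: 8; 2; 5; 22]; [:: 6; 12; 16; 23]; [:: 7; 2; 9; 16]; [::
  23; 2; 5; 7]; [:: 14; 5; 7; 10; 19]; [:: 1; 7; 13; 16; 19]; [:: 15; 4; 11;
  21; 22]; [:: 21; 2; 7; 10; 11]; [:: 7; 1; 13; 15; 22]; [:: 12; 2; 9; 17;
  20]; [:: 11; 0; 9; 15; 21]; [:: 20; 0; 9; 11; 23]; [:: 15; 4; 11; 20; 22];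
  [:: 10; 3; 11; 14; 18]; [:: 9; 2; 3; 20; 22]; [:: 0; 12; 13; 17; 18]; [:: 3;
  2; 10; 11; 20]; [:: 22; 2; 6; 8; 16]; [:: 13; 0; 8; 17; 18]; [:: 19; 0; 11;
  14; 16]; [:: 21; 3; 9; 12; 17]; [:: 6; 2; 4; 8; 23]; [:: 11; 0; 4; 16; 23];
  [:: 5; 1; 6; 14; 22]; [:: 0; 5; 10; 12; 14]; [:: 2; 7; 9; 11; 21]; [:: 14;
  6; 8; 17; 18]; [:: 20; 4; 11; 15; 23]; [:: 17; 4; 6; 19; 20]; [:: 7; 8; 13;
  16; 23]; [:: 20; 2; 3; 9; 12]; [:: 6; 2; 4; 20; 23]; [:: 8; 7; 14; 16; 22];
  [:: 7; 5; 10; 12; 15]; [:: 18; 0; 12; 14; 17]; [:: 4; 2; 6; 16; 23]; [:: 3;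
  11; 14; 17; 20]; [:: 5; 7; 8; 14; 19]; [:: 12; 4; 10; 15; 20]; [:: 2; 4; 7;
  12; 23]; [:: 17; 6; 9; 12; 20]; [:: 17; 3; 11; 18; 21]; [:: 17; 3; 8; 14;
  20]; [:: 20; 3; 9; 12; 15]; [:: 23; 7; 9; 12; 15]; [:: 19; 1; 6; 14; 17];
  [:: 12; 2; 4; 10; 20]; [:: 0; 4; 10; 19; 20]; [:: 17; 3; 11; 19; 20]; [::
  12; 0; 10; 15; 21]; [:: 17; 0; 8; 13; 20]; [:: 15; 6; 9; 12; 23]; [:: 0; 5;
  8; 19; 23]; [:: 23; 1; 5; 7; 9]; [:: 9; 2; 12; 20; 23]; [:: 7; 2; 4; 16;
  22]; [:: 17; 6; 9; 12; 21]; [:: 15; 6; 9; 20; 23]; [:: 3; 9; 12; 18; 21];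
  [:: 18; 0; 8; 14; 16]; [:: 17; 0; 14; 19; 20]; [:: 1; 4; 7; 19; 21]; [:: 8;
  13; 15; 20; 23]; [:: 3; 13; 15; 21; 22]; [:: 3; 12; 14; 17; 20]; [:: 15; 5;
  6; 12; 23]; [:: 19; 0; 8; 16; 23]; [:: 23; 7; 8; 16; 19]; [:: 1; 5; 6; 9;
  22]; [:: 3; 10; 13; 18; 21]; [:: 14; 5; 6; 8; 19]; [:: 6; 1; 4; 15; 23]; [::
  6; 1; 9; 16; 22]; [:: 6; 4; 8; 17; 19]; [:: 0; 10; 11; 19; 20]; [:: 21; 4;
  7; 11; 15]; [:: 6; 4; 8; 15; 23]; [:: 7; 2; 4; 11; 22]; [:: 10; 0; 5; 14;
  19]; [:: 14; 3; 10; 16; 19]; [:: 12; 3; 10; 15; 21]; [:: 7; 9; 11; 16; 23];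
  [:: 7; 4; 11; 16; 22]; [:: 11; 7; 9; 16; 22]; [:: 10; 0; 12; 14; 20]; [::
  23; 4; 7; 8; 19]; [:: 3; 12; 13; 17; 21]; [:: 3; 10; 14; 19; 20]; [:: 4; 6;
  12; 15; 20]; [:: 14; 3; 11; 16; 19]; [:: 21; 2; 7; 10; 12]; [:: 19; 1; 3;
  14; 17]; [:: 21; 0; 4; 10; 12]; [:: 22; 5; 6; 8; 15]; [:: 21; 7; 10; 11;
  15]; [:: 11; 3; 9; 17; 20]; [:: 17; 3; 8; 14; 19]; [:: 7; 5; 9; 15; 22]; [::
  3; 12; 13; 17; 20]; [:: 12; 2; 4; 17; 20]; [:: 9; 2; 11; 21; 22]; [:: 7; 5;
  8; 15; 23]; [:: 8; 3; 14; 16; 22]; [:: 20; 0; 4; 12; 15]; [:: 0; 4; 10; 11;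
  20]; [:: 18; 3; 10; 13; 16]; [:: 1; 6; 9; 15; 21]; [:: 20; 3; 10; 11; 15];
  [:: 21; 1; 6; 9; 17]; [:: 20; 0; 4; 12; 23]; [:: 9; 2; 3; 21; 22]; [:: 1; 5;
  6; 19; 23]; [:: 1; 6; 14; 16; 19]; [:: 8; 7; 13; 16; 22]; [:: 20; 4; 12; 15;
  23]; [:: 0; 10; 12; 18; 21]; [:: 6; 2; 4; 20; 22]; [:: 9; 3; 11; 15; 21];
  [:: 20; 2; 3; 11; 17]; [:: 2; 4; 6; 12; 23]; [:: 23; 5; 6; 9; 15]; [:: 6; 1;
  4; 16; 22]; [:: 11; 0; 9; 17; 20]; [:: 10; 3; 12; 13; 18]; [:: 12; 2; 3; 17;
  21]; [:: 20; 0; 10; 11; 15]; [:: 21; 4; 10; 11; 15]; [:: 3; 10; 13; 19; 20];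
  [:: 11; 2; 7; 9; 22]; [:: 16; 0; 11; 19; 23]; [:: 17; 0; 8; 14; 19]; [:: 8;
  0; 13; 16; 19]; [:: 15; 5; 7; 12; 23]; [:: 21; 2; 4; 10; 11]; [:: 23; 4; 7;
  8; 16]; [:: 9; 7; 11; 15; 23]; [:: 6; 2; 8; 20; 23]; [:: 4; 2; 7; 21; 22];
  [:: 12; 2; 3; 10; 21]; [:: 9; 7; 11; 15; 22]; [:: 13; 3; 8; 16; 19]; [:: 4;
  1; 17; 19; 21]; [:: 15; 1; 4; 7; 22]; [:: 17; 3; 11; 19; 21]; [:: 0; 10; 11;
  18; 21]; [:: 17; 0; 13; 18; 21]; [:: 12; 0; 13; 15; 20]; [:: 16; 3; 8; 14;
  18]; [:: 23; 1; 7; 9; 16]; [:: 15; 1; 7; 9; 21]; [:: 12; 0; 10; 13; 20]; [::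
  11; 0; 4; 15; 21]; [:: 8; 6; 14; 16; 22]; [:: 1; 5; 7; 19; 23]; [:: 15; 1;
  7; 9; 22]; [:: 6; 1; 9; 15; 23]; [:: 12; 0; 10; 13; 21]; [:: 1; 6; 9; 16;
  23]; [:: 7; 2; 4; 11; 23]; [:: 15; 6; 9; 20; 22]; [:: 0; 4; 10; 19; 21]; [::
  17; 0; 13; 19; 20]; [:: 0; 4; 11; 17; 20]; [:: 8; 3; 13; 16; 22]; [:: 10; 0;
  11; 14; 20]; [:: 21; 2; 4; 11; 17]; [:: 17; 0; 13; 19; 21]; [:: 5; 1; 7; 14;
  22]; [:: 7; 2; 8; 16; 23]; [:: 20; 0; 9; 12; 15]; [:: 13; 3; 8; 17; 18]; [::
  10; 3; 12; 14; 18]; [:: 17; 0; 8; 14; 20]; [:: 7; 1; 13; 15; 23]; [:: 23; 6;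
  8; 16; 19]; [:: 21; 0; 4; 12; 17]; [:: 17; 0; 9; 12; 21]; [:: 15; 7; 9; 21;
  22]; [:: 0; 11; 14; 17; 18]; [:: 1; 7; 14; 16; 19]; [:: 0; 11; 14; 17; 19];
  [:: 22; 1; 5; 6; 15]; [:: 4; 6; 12; 15; 21]; [:: 21; 4; 7; 12; 15]; [:: 14;
  0; 10; 16; 19]; [:: 21; 2; 9; 11; 17]; [:: 2; 7; 9; 12; 21]; [:: 22; 4; 7;
  8; 15]; [:: 9; 2; 3; 11; 21]; [:: 22; 2; 4; 7; 8]; [:: 12; 0; 13; 15; 21];
  [:: 23; 1; 4; 7; 16]; [:: 14; 3; 10; 11; 19]; [:: 13; 3; 8; 20; 22]; [:: 13;
  3; 10; 19; 21]; [:: 6; 2; 8; 20; 22]; [:: 6; 4; 8; 16; 22]; [:: 9; 2; 11;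
  20; 22]; [:: 9; 2; 11; 20; 23]; [:: 0; 10; 11; 19; 21]; [:: 21; 3; 12; 17;
  18]; [:: 18; 0; 10; 13; 16]; [:: 7; 1; 5; 15; 23]; [:: 20; 0; 9; 12; 23];
  [:: 4; 2; 6; 12; 20]; [:: 7; 2; 4; 11]; [:: 15; 3; 20; 22]; [:: 21; 4; 10;
  15]; [:: 23; 7; 9; 12]; [:: 17; 0; 9; 21]; [:: 0; 11; 18; 21]; [:: 11; 3; 9;
  17]; [:: 0; 4; 11; 20]; [:: 12; 2; 9; 17]; [:: 10; 11; 14; 18]; [:: 17; 6;
  12; 21]; [:: 17; 3; 19; 21]; [:: 15; 8; 20; 22]; [:: 9; 2; 11; 23]; [:: 17;
  11; 19; 21]; [:: 21; 4; 7; 12]; [:: 10; 12; 14; 20]; [:: 6; 4; 8; 16]; [::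
  6; 4; 8; 19]; [:: 6; 1; 4; 17]; [:: 0; 10; 11; 19]; [:: 23; 4; 7; 19]; [::
  8; 7; 14; 22]; [:: 21; 2; 4; 10]; [:: 9; 11; 15; 23]; [:: 22; 2; 4; 8]; [::
  10; 11; 14; 20]; [:: 15; 7; 21; 22]; [:: 21; 2; 4; 17]; [:: 21; 4; 10; 11];
  [:: 23; 7; 16; 19]; [:: 8; 13; 15; 23]; [:: 9; 3; 11; 15]; [:: 22; 1; 5;
  15]; [:: 7; 2; 8; 16]; [:: 0; 11; 19; 20]; [:: 23; 6; 16; 19]; [:: 13; 3; 8;
  19]; [:: 9; 11; 20; 22]; [:: 12; 2; 3; 17]; [:: 15; 1; 4; 22]; [:: 10; 12;
  13; 18]; [:: 17; 4; 19; 20]; [:: 17; 14; 19; 20]; [:: 13; 3; 8; 20]; [:: 18;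
  3; 10; 16]; [:: 4; 6; 12; 20]; [:: 4; 6; 15; 21]; [:: 23; 5; 6; 9]; [:: 6;
  1; 4; 16]; [:: 15; 13; 20; 22]; [:: 13; 3; 8; 18]; [:: 11; 0; 9; 15]; [::
  21; 4; 11; 17]; [:: 6; 4; 20; 22]; [:: 20; 4; 15; 23]; [:: 20; 0; 10; 15];
  [:: 9; 11; 21; 22]; [:: 6; 4; 8; 15]; [:: 12; 3; 10; 15]; [:: 23; 5; 9; 15];
  [:: 7; 2; 16; 23]; [:: 17; 13; 18; 21]; [:: 14; 0; 10; 16]; [:: 13; 3; 12;
  15]; [:: 11; 2; 3; 9; 20]; [:: 9; 3; 15; 21; 22]; [:: 0; 8; 13; 17; 19]; [::
  0; 4; 17; 19; 21]; [:: 3; 10; 12; 13; 20]; [:: 10; 2; 3; 12; 20]; [:: 18; 0;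
  8; 13; 16]; [:: 21; 1; 4; 7; 15]; [:: 17; 0; 12; 18; 21]; [:: 5; 1; 6; 14;
  19]; [:: 14; 5; 6; 8; 22]; [:: 19; 1; 4; 6; 23]; [:: 1; 6; 9; 15; 22]; [::
  13; 3; 10; 12; 21]; [:: 1; 5; 7; 14; 19]; [:: 14; 0; 10; 12; 18]; [:: 9; 12;
  15; 20; 23]; [:: 22; 5; 7; 8; 15]; [:: 15; 7; 8; 13; 22]; [:: 14; 6; 8; 17;
  19]; [:: 11; 4; 7; 16; 23]; [:: 8; 6; 15; 20; 23]; [:: 10; 7; 12; 15; 21];
  [:: 13; 3; 17; 19; 20]
]%N.

(** Deleting a tetrahedron raises the Euler characteristic by 1 and a collapsible remainder has
    Euler characteristic 1, so the length of this list is forced: it is 1 minus the Euler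
    characteristic of the complex. *)
Definition sphere_cells : seq (seq nat) := [::
  [:: 2; 3; 14; 22]; [:: 0; 5; 9; 11]; [:: 5; 7; 12; 17]; [:: 2; 10; 13; 20];
  [:: 9; 11; 19; 23]; [:: 0; 13; 16; 22]; [:: 0; 4; 16; 18]; [:: 6; 9; 18;
  21]; [:: 9; 12; 16; 18]; [:: 4; 8; 17; 21]; [:: 3; 9; 16; 22]; [:: 8; 14;
  15; 20]; [:: 1; 6; 19; 20]; [:: 3; 11; 16; 23]; [:: 4; 6; 10; 19]; [:: 5; 7;
  10; 12]; [:: 7; 10; 11; 14]; [:: 4; 11; 16; 23]; [:: 0; 5; 12; 23]; [:: 2;
  4; 7; 16]; [:: 6; 9; 16; 22]; [:: 1; 6; 9; 21]; [:: 1; 5; 9; 22]; [:: 6; 9;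
  12; 17]; [:: 4; 6; 17; 19]; [:: 1; 6; 9; 15]; [:: 0; 4; 11; 23]; [:: 1; 4;
  6; 19]; [:: 1; 4; 19; 21]; [:: 1; 13; 15; 21]; [:: 7; 10; 12; 15]; [:: 8;
  13; 15; 22]; [:: 8; 15; 20; 23]; [:: 9; 12; 15; 23]; [:: 2; 9; 12; 23]; [::
  2; 6; 20; 22]; [:: 2; 4; 6; 22]; [:: 2; 4; 21; 22]; [:: 4; 7; 11; 22]; [::
  7; 9; 11; 15]; [:: 1; 7; 15; 22]; [:: 5; 7; 15; 22]; [:: 5; 8; 18; 22]; [::
  5; 6; 18; 23]; [:: 2; 5; 6; 23]; [:: 0; 5; 8; 23]; [:: 5; 6; 14; 22]; [:: 6;
  8; 19; 23]; [:: 1; 5; 7; 14]; [:: 5; 8; 14; 19]; [:: 7; 8; 19; 23]; [:: 1;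
  7; 16; 23]; [:: 0; 8; 16; 19]; [:: 6; 8; 14; 16]; [:: 3; 9; 15; 20]; [:: 4;
  11; 15; 21]; [:: 0; 11; 15; 21]; [:: 3; 8; 13; 16]; [:: 8; 13; 17; 18]; [::
  10; 13; 16; 18]; [:: 1; 3; 16; 19]; [:: 1; 14; 17; 19]; [:: 1; 3; 14; 18];
  [:: 2; 10; 11; 21]; [:: 2; 11; 17; 21]; [:: 2; 3; 9; 11]; [:: 3; 9; 11; 21];
  [:: 9; 11; 17; 20]; [:: 4; 12; 17; 20]; [:: 4; 10; 12; 20]; [:: 0; 12; 13;
  20]; [:: 3; 13; 19; 20]; [:: 3; 10; 11; 20]; [:: 3; 10; 11; 18]; [:: 3; 11;
  14; 19]; [:: 3; 10; 14; 19]; [:: 10; 12; 14; 18]; [:: 3; 10; 18; 21]; [:: 3;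
  12; 17; 21]; [:: 0; 10; 12; 21]; [:: 0; 13; 17; 19]
]%N.

(** The last row slides vertex 17 onto vertex 5, the point that is left in [core_contracts]. *)
Definition contraction_steps : seq (seq nat) := [::
  [:: 8; 18; 23]; [:: 6; 18; 22]; [:: 8; 2; 5]; [:: 8; 5; 18]; [:: 19; 10; 13;
  16]; [:: 3; 10; 13; 20]; [:: 9; 2; 21; 22]; [:: 14; 6; 8; 19]; [:: 19; 5; 7;
  17]; [:: 12; 2; 3; 14]; [:: 15; 1; 6; 20]; [:: 7; 5; 8; 23]; [:: 3; 9; 18;
  21]; [:: 17; 6; 19; 20]; [:: 17; 8; 14; 20]; [:: 15; 6; 20; 22]; [:: 16; 11;
  19; 23]; [:: 20; 0; 12; 23]; [:: 23; 4; 6; 19]; [:: 15; 4; 11; 22]; [:: 14;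
  1; 3; 16]; [:: 1; 6; 9; 22]; [:: 7; 4; 11; 23]; [:: 15; 0; 13; 22]; [:: 6;
  9; 12; 16]; [:: 11; 9; 16; 22]; [:: 9; 15; 20; 23]; [:: 17; 9; 11; 19]; [::
  8; 3; 16; 22]; [:: 22; 4; 8; 21]; [:: 9; 2; 20; 22]; [:: 21; 7; 11; 15]; [::
  16; 7; 11; 14]; [:: 10; 0; 5; 11]; [:: 23; 1; 4; 19]; [:: 17; 6; 9; 21]; [::
  5; 6; 10; 19]; [:: 13; 1; 19; 20]; [:: 10; 3; 19; 20]; [:: 11; 0; 4; 16];
  [:: 7; 2; 10; 13]; [:: 13; 3; 10; 21]; [:: 8; 3; 14; 22]; [:: 7; 5; 9; 22];
  [:: 14; 10; 16; 18]; [:: 19; 1; 13; 21]; [:: 21; 0; 4; 18]; [:: 3; 10; 12;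
  18]; [:: 21; 7; 12; 17]; [:: 14; 5; 6; 8]; [:: 1; 9; 19; 23]; [:: 14; 8; 17;
  18]; [:: 0; 4; 19; 21]; [:: 9; 2; 3; 22]; [:: 6; 4; 8; 17]; [:: 0; 5; 12;
  17]; [:: 13; 3; 15; 20]; [:: 20; 2; 11; 17]; [:: 18; 0; 13; 16]; [:: 7; 5;
  9; 11]; [:: 1; 7; 19; 23]; [:: 10; 14; 15; 20]; [:: 20; 9; 12; 23]; [:: 6;
  4; 16; 18]; [:: 13; 8; 17; 21]; [:: 16; 6; 9; 18]; [:: 6; 2; 14; 22]; [:: 3;
  2; 10; 11]; [:: 17; 0; 13; 20]; [:: 17; 3; 11; 21]; [:: 0; 4; 17; 19]; [::
  3; 9; 12; 18]; [:: 20; 3; 11; 23]; [:: 0; 4; 10; 19]; [:: 12; 0; 15; 21];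
  [:: 22; 2; 7; 16]; [:: 14; 12; 16; 18]; [:: 0; 10; 11; 18]; [:: 7; 2; 4;
  22]; [:: 0; 10; 18; 21]; [:: 8; 2; 13; 20]; [:: 23; 1; 5; 9]; [:: 5; 8; 14;
  15]; [:: 12; 4; 6; 10]; [:: 15; 5; 12; 23]; [:: 17; 3; 11; 19]; [:: 6; 4;
  16; 23]; [:: 18; 1; 14; 17]; [:: 17; 3; 11; 18]; [:: 11; 0; 16; 22]; [:: 12;
  2; 17; 21]; [:: 6; 2; 4; 16]; [:: 23; 0; 5; 9]; [:: 0; 4; 10; 20]; [:: 15;
  5; 7; 12]; [:: 18; 0; 8; 16]; [:: 13; 3; 16; 23]; [:: 17; 9; 19]; [:: 13; 8;
  21]; [:: 13; 3; 23]; [:: 20; 2; 17]; [:: 6; 12; 16]; [:: 15; 1; 20]; [:: 6;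
  2; 14]; [:: 8; 2; 13]; [:: 21; 4; 10]; [:: 21; 7; 17]; [:: 3; 9; 18]; [::
  15; 20; 22]; [:: 17; 11; 18]; [:: 10; 5; 11]; [:: 11; 0; 22]; [:: 6; 4; 18];
  [:: 7; 5; 9]; [:: 10; 14; 15]; [:: 6; 2; 16]; [:: 23; 4; 19]; [:: 19; 10;
  16]; [:: 5; 6; 10]; [:: 7; 1; 13; 15]; [:: 9; 11; 15; 22]; [:: 12; 0; 13;
  15]; [:: 0; 10; 19; 20]; [:: 6; 5; 12; 15]; [:: 7; 11; 16; 22]; [:: 14; 3;
  10; 11]; [:: 1; 6; 9; 16]; [:: 11; 3; 9; 16]; [:: 0; 5; 10; 12]; [:: 21; 1;
  9; 17]; [:: 17; 0; 18; 21]; [:: 22; 4; 6; 16]; [:: 14; 3; 8; 16]; [:: 3; 1;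
  17; 18]; [:: 17; 6; 18; 21]; [:: 20; 0; 4; 23]; [:: 20; 6; 9; 17]; [:: 17;
  13; 19; 20]; [:: 3; 13; 21; 22]; [:: 8; 2; 6; 22]; [:: 19; 0; 5; 23]; [::
  10; 1; 14; 18]; [:: 20; 2; 3; 11]; [:: 21; 2; 3; 9]; [:: 0; 4; 11; 15]; [::
  6; 2; 8; 20]; [:: 21; 2; 7; 10]; [:: 13; 3; 10; 19]; [:: 11; 2; 9; 22]; [::
  15; 1; 9; 22]; [:: 15; 6; 9; 12]; [:: 7; 1; 19; 21]; [:: 0; 11; 17; 19]; [::
  1; 6; 19; 23]; [:: 8; 6; 14; 22]; [:: 17; 8; 14; 19]; [:: 7; 1; 4; 23]; [::
  4; 12; 20; 23]; [:: 15; 4; 21; 22]; [:: 21; 3; 12; 18]; [:: 7; 4; 11; 16];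
  [:: 14; 0; 16; 18]; [:: 8; 13; 20; 23]; [:: 20; 0; 9; 23]; [:: 13; 3; 8;
  22]; [:: 22; 5; 8; 15]; [:: 21; 7; 10; 11]; [:: 7; 5; 10; 15]; [:: 9; 21;
  22]; [:: 17; 18; 21]; [:: 7; 4; 16]; [:: 7; 2; 22]; [:: 17; 3; 8]; [:: 14;
  5; 12]; [:: 3; 1; 10]; [:: 17; 19; 20]; [:: 21; 4; 11]; [:: 9; 11; 22]; [::
  20; 0; 15]; [:: 3; 1; 18]; [:: 15; 3; 22]; [:: 23; 2; 8]; [:: 19; 1; 3]; [::
  7; 9; 22]; [:: 21; 3; 15]; [:: 6; 1; 17]; [:: 4; 6; 21]; [:: 8; 7; 16; 22];
  [:: 7; 13; 15; 22]; [:: 14; 6; 17; 19]; [:: 12; 9; 17; 20]; [:: 20; 3; 9;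
  11]; [:: 23; 1; 9; 16]; [:: 7; 9; 11; 16]; [:: 23; 5; 7; 15]; [:: 14; 6; 17;
  18]; [:: 23; 1; 6; 9]; [:: 14; 3; 11; 16]; [:: 2; 7; 11; 21]; [:: 14; 5; 7;
  10]; [:: 6; 5; 15; 22]; [:: 10; 7; 19; 21]; [:: 15; 1; 9; 21]; [:: 6; 4; 20;
  23]; [:: 12; 3; 9; 21]; [:: 1; 5; 19; 23]; [:: 10; 2; 3; 20]; [:: 12; 13;
  15; 21]; [:: 12; 2; 3; 21]; [:: 0; 8; 17; 19]; [:: 19; 0; 14; 16]; [:: 20;
  9; 12; 15]; [:: 21; 7; 10; 15]; [:: 0; 10; 11; 14]; [:: 7; 8; 13; 23]; [::
  17; 6; 12; 14]; [:: 5; 1; 6; 19]; [:: 13; 3; 17; 18]; [:: 15; 6; 9; 20]; [::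
  16; 8; 13; 22]; [:: 13; 3; 17; 21]; [:: 15; 1; 4; 6]; [:: 2; 4; 12; 23]; [::
  9; 2; 11; 20]; [:: 6; 1; 15; 22]; [:: 21; 1; 4; 7]; [:: 12; 2; 10; 21]; [::
  12; 3; 21]; [:: 6; 5; 15]; [:: 21; 1; 4]; [:: 7; 9; 16]; [:: 17; 3; 11]; [::
  7; 1; 9]; [:: 23; 6; 9]; [:: 14; 6; 19]; [:: 20; 3; 9]; [:: 10; 2; 3]; [::
  20; 2; 10]; [:: 7; 1; 21]; [:: 1; 13; 22]; [:: 9; 2; 11]; [:: 23; 7; 11];
  [:: 23; 1; 15]; [:: 1; 5; 6]; [:: 7; 5; 23]; [:: 16; 1; 6]; [:: 3; 12; 17;
  20]; [:: 7; 9; 15; 23]; [:: 19; 11; 14; 16]; [:: 8; 5; 7; 14]; [:: 0; 11;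
  16; 23]; [:: 16; 1; 19; 23]; [:: 13; 1; 7; 23]; [:: 11; 9; 15; 20]; [:: 8;
  6; 16; 23]; [:: 0; 11; 14; 17]; [:: 0; 13; 17; 18]; [:: 4; 6; 12; 17]; [::
  0; 11; 17; 20]; [:: 18; 6; 14; 16]; [:: 19; 7; 10; 14]; [:: 5; 1; 7; 22];
  [:: 20; 9; 11; 23]; [:: 14; 1; 16; 22]; [:: 8; 6; 14; 17]; [:: 12; 7; 10;
  21]; [:: 8; 6; 16; 22]; [:: 8; 6; 18]; [:: 8; 6; 14]; [:: 14; 16; 22]; [::
  14; 1; 22]; [:: 19; 0; 16]; [:: 21; 9; 15]; [:: 19; 11; 16]; [:: 13; 1; 23];
  [:: 14; 11; 19]; [:: 7; 13; 23]; [:: 0; 11; 23]; [:: 8; 6; 16]; [:: 20; 6;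
  17]; [:: 2; 9; 23]; [:: 0; 11; 14]; [:: 13; 7; 10]; [:: 19; 1; 5]; [:: 5;
  14; 22]; [:: 10; 11; 15]; [:: 8; 16; 23]; [:: 21; 7; 9]; [:: 8; 5; 22]; [::
  8; 19; 23]; [:: 20; 0; 23]; [:: 12; 10; 15]; [:: 8; 5; 7]; [:: 6; 20; 23];
  [:: 0; 11; 20]; [:: 12; 2; 9]; [:: 21; 10; 11]; [:: 17; 11]; [:: 12; 9]; [::
  4; 15; 21]; [:: 4; 2; 20]; [:: 0; 5; 8]; [:: 10; 5; 14]; [:: 13; 8; 19]; [::
  15; 6; 20]; [:: 2; 7; 21]; [:: 1; 7; 19]; [:: 23; 2; 7]; [:: 12; 2; 21]; [::
  16; 1]; [:: 6; 2]; [:: 15; 12; 23]; [:: 16; 7; 14]; [:: 13; 7; 12]; [:: 15;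
  6; 12]; [:: 8; 4; 23]; [:: 13; 7; 16]; [:: 3; 16; 19]; [:: 18; 16]; [:: 15;
  23]; [:: 22; 6]; [:: 7; 22]; [:: 0; 8; 14]; [:: 13; 8; 18]; [:: 15; 7; 13];
  [:: 20; 12; 15]; [:: 10; 3; 18]; [:: 17; 3; 19]; [:: 7; 4; 8]; [:: 15; 7];
  [:: 20; 15]; [:: 17; 8]; [:: 0; 13; 18]; [:: 14; 10; 18]; [:: 3; 13; 20];
  [:: 0; 14; 19]; [:: 0; 4; 20]; [:: 21; 4]; [:: 12; 3; 13]; [:: 14; 17; 20];
  [:: 10; 12; 20]; [:: 14; 3]; [:: 10; 20]; [:: 0; 10; 14]; [:: 18; 14; 17];
  [:: 12; 18]; [:: 0; 14]; [:: 0; 12; 17]; [:: 13; 10; 12]; [:: 21; 12]; [::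
  19; 10; 21]; [:: 17; 21]; [:: 5; 10]; [:: 5; 13]; [:: 0; 19]; [:: 17; 0];
  [:: 5; 17]
]%N.


(** * Verification of the certificates and conclusion *)

Definition vertices := map cells Delta3_edges.

(** 28 = 12 + 12 + 4 counts the incidences of vertices with edges, edges with triangles and
    triangles with the tetrahedron. *)
Definition bits28 (s : seq nat) : bitseq := mkseq (fun i => i \in s) 28.

Definition Delta3_faces := pure_bits Delta3_edges 7 Delta3_edges.

Definition bDelta3_faces := pure_bits bDelta3_edges 6 Delta3_edges.

Definition core_faces := odflt [::] (collapses 28 bDelta3_faces bDelta3_steps).

Definition spheres := map bits28 sphere_cells.

Lemma size_vertices : size vertices = 28%N.
Proof. by rewrite size_map; vm_compute. Qed.

Lemma vertices_uniq : uniq vertices.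
Proof. by rewrite (map_inj_uniq cells_inj) Delta3_edges_uniq. Qed.

(** 15 simplices, of which all but one vertex are matched: 15 = 2 * 7 + 1. *)
Lemma Delta3_optimal : optimal_size Delta3_edges 7.
Proof. by vm_compute. Qed.

(** 14 simplices, of which a vertex and a triangle stay unmatched, as the homology of the 2-sphere
    demands: 14 = 2 * 6 + 2. *)
Lemma bDelta3_optimal : optimal_size bDelta3_edges 6.
Proof. by vm_compute. Qed.

(** Each row removes the star of a simplex containing one of the positions 24 to 27, and the last
    four rows remove these vertices themselves. Equality of lists can be asked for since filtering
    preserves the lexicographic order of [faces]. *)
Lemma Delta3_collapses : collapses 28 Delta3_faces Delta3_steps == Some bDelta3_faces.
Proof. by vm_compute. Qed.

Lemma bDelta3_collapses : isSome (collapses 28 bDelta3_faces bDelta3_steps).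
Proof. by vm_compute. Qed.

Lemma size_core_faces : all (fun b => size b == 28%N) core_faces.
Proof. by vm_compute. Qed.

Lemma spheres_facets : bit_facets core_faces spheres.
Proof. by vm_compute. Qed.

Lemma core_contracts :
  collapses 28 [seq b <- core_faces | b \notin spheres] contraction_steps ==
  Some [:: bits28 [:: 5%N]].
Proof. by vm_compute. Qed.

Lemma pure_Delta3E :
  pure_morse_complex Delta3 = cset vertices Delta3_faces.
Proof.
exact: (pure_morse_complexE Delta3_edges_uniq hasse_Delta3 Delta3_optimal
  Delta3_edges_uniq).
Qed.

Lemma pure_bDelta3E :
  pure_morse_complex bDelta3 = cset vertices bDelta3_faces.
Proof.
apply: (pure_morse_complexE bDelta3_edges_uniq hasse_bDelta3 bDelta3_optimal
  Delta3_edges_uniq).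
by move=> p; rewrite mem_Delta3_edges -mem_bDelta3_edges => ->.
Qed.

Lemma odflt_some (T : Type) (x : T) (o : option T) : isSome o ->
  o = Some (odflt x o).
Proof. by case: o. Qed.

Theorem mainTheorem12 (R : realType) :
  homotopy_equivalent R (realization R (pure_morse_complex Delta3))
                        (realization R (pure_morse_complex bDelta3)) /\
  homotopy_equivalent R (realization R (pure_morse_complex bDelta3))
                        (wedge_S3 R 81).
Proof.
have c3 := is_complex_pure Delta3; have c2 := is_complex_pure bDelta3.
rewrite pure_Delta3E pure_bDelta3E in c3 c2 *; split.
  apply: strong_deformation_retract_equiv.
  have := @collapsesP _ _ vertices_uniq R Delta3_faces Delta3_steps bDelta3_faces c3.
  by rewrite size_vertices => /(_ (eqP Delta3_collapses))[].
have -> : 81%N = size spheres by vm_compute.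
have := @bit_wedge R _ _ vertices_uniq bDelta3_faces core_faces bDelta3_steps
  contraction_steps spheres (bits28 [:: 5%N]) c2.
rewrite size_vertices; apply.
- exact: odflt_some bDelta3_collapses.
- exact: size_core_faces.
- by vm_compute.
- exact: spheres_facets.
- exact: (eqP core_contracts).
- by vm_compute.
- by vm_compute.
Qed.
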